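(* There exists an absolute constant $C_{\mathrm{pen}}>0$ such that the following holds for all $n\ge1$, $\sigma>0$ and $\theta^*\in\mathbb{R}^n$. For any pair $(\Pi,\mathbf V)$ with $\Pi=(A_1,\dots,A_m)$ a connected partition of $[n]$ and $\mathbf V=(V_1,\dots,V_m)\in\mathscr V(m)$, define $$\mathrm{pen}(\Pi,\mathbf V)=C_{\mathrm{pen}}\left(\sum_{i=1}^m\sigma^{4/3}|A_i|^{1/3}V_i^{2/3}+\sigma^2m\log\frac{en}{m}\right).$$ Let $(\hat\Pi,\hat{\mathbf V})$ be a minimizer of $\|y-\hat\theta_{\Pi,\mathbf V}\|_2^2+\mathrm{pen}(\Pi,\mathbf V)$ over all connected partitions $\Pi$ of $[n]$ and all $\mathbf V\in\mathscr V(|\Pi|)$. Then $$\frac1n\mathbb{E}_{\theta^*}\|\hat\theta_{\hat\Pi,\hat{\mathbf V}}-\theta^*\|_2^2\le\min_{\Pi}\min_{\mathbf V\in\mathscr V(|\Pi|)}\left\{\frac3n\mathrm{dist}^2(\theta^*,K_\Pi^\uparrow(\mathbf V))+\frac2n\mathrm{pen}(\Pi,\mathbf V)\right\}+\frac{256\sigma^2}{n}.$$ In particular, if $\theta^*$ is piecewise monotone on $\Pi=(A_1,\dots,A_m)$, then $$\frac1n\mathbb{E}_{\theta^*}\|\hat\theta_{\hat\Pi,\hat{\mathbf V}}-\theta^*\|_2^2\le2C_{\mathrm{pen}}\left\{\sum_{i=1}^m\frac{|A_i|}{n}\left(\frac{\sigma^2(\mathcal V(\theta^*_{A_i})+1)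}{|A_i|}\right)^{2/3}+\frac{\sigma^2m}{n}\log\frac{en}{m}\right\}+\frac{256\sigma^2}{n}.$$
   Context: $y\sim N(\theta^*,\sigma^2I_n)$, and $\mathbb{E}_{\theta^*}$ is with respect to $y$. A connected partition $\Pi=(A_1,\dots,A_m)$ of $[n]=\{1,\dots,n\}$ is a partition into consecutive intervals; $|\Pi|=m$. $\theta\in\mathbb{R}^n$ is piecewise monotone on $\Pi$ if each subvector $\theta_{A_i}$ is nondecreasing; $K_\Pi^\uparrow$ is the set of such $\theta$. $\mathcal V(u)=\sum_i|u_i-u_{i+1}|$ is the total variation of a vector $u$. For $\mathbf V=(V_1,\dots,V_m)$ with $V_i\ge0$, $K_\Pi^\uparrow(\mathbf V)=\{\theta\in K_\Pi^\uparrow:\mathcal V(\theta_{A_i})\le V_i\text{ for }i=1,\dots,m\}$, and $\hat\theta_{\Pi,\mathbf V}$ is the Euclidean projection of $y$ onto $K_\Pi^\uparrow(\mathbf V)$. $\mathscr V(m)=\{(v(j_1),\dots,v(j_m)):(j_1,\dots,j_m)\in\mathbb{N}^m\}$ with $v(j)=j^{3/2}$ and $\mathbb{N}=\{1,2,\dots\}$. $\mathrm{dist}(\theta^*,K)=\inf_{\theta\in K}\|\theta^*-\theta\|_2$. *)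

(* Defs.v *)
From mathcomp Require Export all_boot all_order all_algebra.
From mathcomp Require Export all_classical all_reals all_analysis.

Set Implicit Arguments.
Unset Strict Implicit.
Unset Printing Implicit Defensive.

Import Order.TTheory GRing.Theory Num.Theory.
Import numFieldNormedType.Exports.

Local Open Scope classical_set_scope.
Local Open Scope ring_scope.

(* Vectors of R^n are row vectors; since the library norm on 'rV is the sup
   norm, the Euclidean norm is defined here. *)
Definition enorm (R : realType) (n : nat) (u : 'rV[R]_n) : R :=
  Num.sqrt (\sum_(i < n) u 0 i ^+ 2).

Definition dist (R : realType) (n : nat) (x : 'rV[R]_n)
    (K : set 'rV[R]_n) : R :=
  inf [set enorm (x - u) | u in K].

Definition is_proj (R : realType) (n : nat) (K : set 'rV[R]_n)
    (x p : 'rV[R]_n) : Prop :=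
  K p /\ forall u, K u -> enorm (x - p) <= enorm (x - u).

(* The default value 0 is irrelevant for nonempty closed convex K, where the
   projection exists and is unique. *)
Definition proj (R : realType) (n : nat) (K : set 'rV[R]_n)
    (x : 'rV[R]_n) : 'rV[R]_n :=
  xget 0 [set p | is_proj K x p].

Definition is_min (R : realType) (S : set R) (b : R) : Prop :=
  S b /\ lbound S b.

(* N(theta, sigma^2 I_n) is the product of the laws N(theta_i, sigma^2); the
   second parameter of normal_prob is the standard deviation. *)
Definition gaussian_vector (R : realType) (n : nat) (d : measure_display)
    (T : measurableType d) (P : probability T R) (y : T -> 'rV[R]_n)
    (theta : 'rV[R]_n) (sigma : R) : Prop :=
  (forall i, measurable_fun [set: T] (fun w => y w 0 i)) /\
  (forall B : 'I_n -> set R, (forall i, measurable (B i)) ->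
    P [set w | forall i, B i (y w 0 i)] =
      (\prod_(i < n) normal_prob (theta ord0 i) sigma (B i))%E).

(* A_1, ..., A_m are listed from left to right, so that a partition into
   intervals has exactly one indexing; 'I_n plays the role of [n]. *)
Record connected_partition (n m : nat) (A : 'I_m -> {set 'I_n}) : Prop := {
  cp_nonempty : forall i, A i != finset.set0 ;
  cp_disjoint : forall i j, i != j -> A i :&: A j = finset.set0 ;
  cp_cover : forall k, exists i, k \in A i ;
  cp_interval : forall i (j k l : 'I_n),
    (j <= k <= l)%N -> j \in A i -> l \in A i -> k \in A i ;
  cp_ordered : forall (i j : 'I_m) (k l : 'I_n),
    (i < j)%N -> k \in A i -> l \in A j -> (k < l)%N }.

(* enum lists the elements of B in increasing order. *)
Definition subvec (R : realType) (n : nat) (theta : 'rV[R]_n)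
    (B : {set 'I_n}) : seq R :=
  [seq theta 0 k | k <- enum B].

Definition tv (R : realType) (u : seq R) : R :=
  \sum_(0 <= k < (size u).-1) `|u`_k - u`_k.+1|.

Definition piecewise_monotone (R : realType) (n m : nat)
    (A : 'I_m -> {set 'I_n}) (theta : 'rV[R]_n) : Prop :=
  forall i, sorted <=%R (subvec theta (A i)).

Definition Kup (R : realType) (n m : nat) (A : 'I_m -> {set 'I_n})
    (V : 'I_m -> R) : set 'rV[R]_n :=
  [set theta | piecewise_monotone A theta /\
               forall i, tv (subvec theta (A i)) <= V i].

Definition Vset (R : realType) (m : nat) : set ('I_m -> R) :=
  [set V | exists j : 'I_m -> nat,
     forall i, (0 < j i)%N /\ V i = (j i)%:R `^ (3 / 2)].

Definition pen (R : realType) (n m : nat) (Cpen sigma : R)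
    (A : 'I_m -> {set 'I_n}) (V : 'I_m -> R) : R :=
  Cpen * (\sum_(i < m) sigma `^ (4 / 3) * #|A i|%:R `^ (1 / 3)
                         * V i `^ (2 / 3)
          + sigma ^+ 2 * m%:R * ln (expR 1 * n%:R / m%:R)).

Definition estimator (R : realType) (n m : nat) (y : 'rV[R]_n)
    (A : 'I_m -> {set 'I_n}) (V : 'I_m -> R) : 'rV[R]_n :=
  proj (Kup A V) y.

Definition criterion (R : realType) (n m : nat) (Cpen sigma : R)
    (y : 'rV[R]_n) (A : 'I_m -> {set 'I_n}) (V : 'I_m -> R) : R :=
  enorm (y - estimator y A V) ^+ 2 + pen Cpen sigma A V.

Definition is_minimizer (R : realType) (n m : nat) (Cpen sigma : R)
    (y : 'rV[R]_n) (A : 'I_m -> {set 'I_n}) (V : 'I_m -> R) : Prop :=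
  [/\ connected_partition A, Vset V &
      forall (m' : nat) (A' : 'I_m' -> {set 'I_n}) (V' : 'I_m' -> R),
        connected_partition A' -> Vset V' ->
        criterion Cpen sigma y A V <= criterion Cpen sigma y A' V'].

(* Main.v *)
Require Import Defs.
From mathcomp Require Import measurable_realfun ring lra zify.

Set Implicit Arguments.
Unset Strict Implicit.
Unset Printing Implicit Defensive.

Import Order.TTheory GRing.Theory Num.Theory.
Import numFieldNormedType.Exports.

Local Open Scope classical_set_scope.
Local Open Scope ring_scope.

(** Write [y = theta + sigma z] with [z] white noise, and [pen = Cpen * c] where
    [c(A, V)] is [complexity].  If [u] is the selected estimator, fitted with
    the selected pair [(A', V')], and [f] is any point of [Kup A V], minimality
    of the criterion gives
      [|u - theta|^2 <= |f - theta|^2 + 2 sigma <z, u - f> + pen(A, V) - pen(A', V')].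
    Everything rests on a bound of the noise term that holds for all pairs
    [(A', V')] and all [u] in [Kup A' V'] at once ([noise_bound]):
      [2 sigma <z, u - f> <= |u - f|^2 / 8 + C (c(A, V) + c(A', V')) + 64 sigma^2 Y]
    with [C] absolute and [E Y <= 2].  A large [Cpen] absorbs [C c(A', V')] into
    [pen(A', V')], and since [sigma^2 <= c(A, V)] it also makes all remaining
    terms a small fraction of [pen(A, V)]: the expected loss is at most
    [5/3 |f - theta|^2 + 3/2 pen(A, V)] ([expected_oracle]).  The first claim is
    immediate.  In the second one, the variations of [theta] are rounded up to
    numbers [j^(3/2)]; this may multiply the main term by as much as [2^(1/3)],
    which fits in the gap between [3/2] and [2] ([level_ceiling]).

    The noise bound rests on total variations.  Cut [[n]] at the break
    points of both partitions and consider a block of length [N] on which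
    [g = u - f] has total variation [W].  Expand [g] and [z] in the Haar basis
    obtained by halving the block repeatedly, with coefficients [gamma] and
    [xi].  At depth at most [J], [2 sigma xi gamma <= gamma^2/8 + 8 sigma^2 xi^2].
    At depth [J + r], the same is done only with the excess of [|xi|] over the
    threshold [2r], and the rest costs [4 r sigma |gamma|].  A coefficient on an
    interval of length [L] is at most [sqrt(L - 1)] times the variation of [g]
    there, and the variations at one depth add up to at most [W], so these costs
    sum over [r] to [O(sigma sqrt(N / 2^J) W)] ([coarse_cost]).  There are at
    most [2^(J+r)] excesses at depth [J + r], but the logarithm of the exponential
    moment of each is [O(exp(-2 r^2))], so that together they weigh [O(2^J)]
    ([block_mass]).  Choosing [2^J] of order [N (V / (sigma |A|))^(2/3)] balances
    both terms at [sigma^(4/3) |A|^(1/3) V^(2/3)]: the thresholds growing with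
    the depth are what removes the logarithmic factor that a union bound over
    piecewise constant approximations would leave.

    The exponential of a squared excess is dominated by a series of exponentials
    [exp(s xi)] ([excess_le_majorant]); hence the joint exponential moment of all
    excesses of an orthonormal family follows from [E exp <v, z> = exp(|v|^2/2)]
    alone ([majorant_prod_mgf]).  Summing over all sets of break points and all
    levels [J] gives [Y]; a set of [M] break points is paid by
    [M log(en/M)], the last term of the penalty ([label_count]). *)

(** * Gaussian vectors through their moment generating function *)

Section change_of_law.
Context d d' (T : measurableType d) (T' : measurableType d') (R : realType).
Variables (mu : {measure set T -> \bar R}) (X : T -> T')
  (nu : {measure set T' -> \bar R}) (G : T -> R) (c : R).
Hypothesis mX : measurable_fun setT X.
Hypothesis mG : measurable_fun setT G.
Hypothesis G0 : forall t, 0 <= G t.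
Hypothesis mu_nu : forall B, measurable B ->
  (\int[mu]_t (G t * \1_B (X t))%:E = c%:E * nu B)%E.

Import HBNNSimple.

Let mind (B : set T') : measurable B ->
  measurable_fun setT (fun t => (G t * \1_B (X t) : R)%:E).
Proof.
move=> mB; apply/measurable_EFinP; apply: measurable_funM => //.
by apply: measurableT_comp mX; exact: measurable_indic.
Qed.

Let simple (g : {nnsfun T' >-> R}) :
  (\int[mu]_t (G t * g (X t))%:E = c%:E * \int[nu]_x (g x)%:E)%E.
Proof.
rewrite integralT_nnsfun sintegralE.
transitivity (\int[mu]_t
    (\sum_(y \in range g) (Num.max y 0 * (G t * \1_(g @^-1` [set y]) (X t)))%:E))%E.
  apply: eq_integral => t _; rewrite fsumEFin//; congr EFin.
  rewrite [in LHS]fimfunE mulr_fsumr; apply: eq_fsbigr => y /set_mem[x _ <-].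
  by rewrite mulrCA max_l.
rewrite ge0_integral_fsum//=; last 2 first.
- move=> y; under eq_fun do rewrite EFinM.
  by apply: measurable_funeM; apply: mind.
- by move=> y t _; rewrite lee_fin mulr_ge0 ?mulr_ge0 ?le_max ?lexx ?orbT// .
rewrite ge0_mule_fsumr; last first.
  by move=> y; apply: nnsfun_mulemu_ge0.
apply: eq_fsbigr => y /set_mem[x _ <-].
rewrite max_l//; under eq_integral do rewrite EFinM.
rewrite ge0_integralZl//=; first by rewrite mu_nu// muleCA.
- exact: mind.
- by move=> t _; rewrite lee_fin mulr_ge0.
- by rewrite lee_fin.
Qed.

(** If [G dmu] pushed forward by [X] agrees with [c nu] on measurable sets, then it
    does so on nonnegative functions.  This one statement yields both the
    factorization of expectations of independent variables and the passage from
    a law to its density. *)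
Lemma change_of_law (phi : T' -> R) : measurable_fun setT phi ->
  (forall x, 0 <= phi x) ->
  (\int[mu]_t (G t * phi (X t))%:E = c%:E * \int[nu]_x (phi x)%:E)%E.
Proof.
move=> mphi phi0.
have mphi' : measurable_fun setT (EFin \o phi) by exact/measurable_EFinP.
pose g := nnsfun_approx measurableT mphi'.
have gcvg x : (g n x)%:E @[n --> \oo] --> (phi x)%:E.
  by apply: (cvg_nnsfun_approx measurableT mphi') => // y _; rewrite lee_fin.
have gnd x : {homo (fun n => g n x) : m n / (m <= n)%N >-> m <= n}.
  by move=> m n mn; exact/lefP/nd_nnsfun_approx.
transitivity (limn (fun n => \int[mu]_t (G t * g n (X t))%:E)%E).
  rewrite -monotone_convergence//=.
  - apply: eq_integral => t _; apply/esym/cvg_lim => //.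
    under eq_fun do rewrite EFinM.
    by rewrite EFinM; apply: cvgeZl => //; exact: gcvg.
  - move=> n; apply/measurable_EFinP; apply: measurable_funM => //.
    exact: (measurableT_comp (measurable_funPT (g n))).
  - by move=> n t _; rewrite lee_fin mulr_ge0.
  - by move=> t _ m n mn; rewrite lee_fin ler_wpM2l// gnd.
under eq_fun do rewrite simple.
have -> : (\int[nu]_x (phi x)%:E = limn (fun n => \int[nu]_x (g n x)%:E))%E.
  rewrite -monotone_convergence//=.
  - by apply: eq_integral => t _; apply/esym/cvg_lim => //; exact: gcvg.
  - by move=> n; apply/measurable_EFinP; exact: (measurable_funPT (g n)).
  - by move=> n t _; rewrite lee_fin.
  - by move=> t _ m n mn; rewrite lee_fin gnd.
have ndI : {homo (fun n => \int[nu]_x (g n x)%:E)%E : m n / (m <= n)%N >-> (m <= n)%E}.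
  move=> m n mn; apply: ge0_le_integral => //.
  - by move=> x _; rewrite lee_fin.
  - by apply/measurable_EFinP; exact: (measurable_funPT (g m)).
  - by apply/measurable_EFinP; exact: (measurable_funPT (g n)).
  - by move=> x _; rewrite lee_fin gnd.
have cvI := ereal_nondecreasing_is_cvgn ndI.
exact: limeMl.
Qed.
End change_of_law.

Section product_law.
Context d d' (T : measurableType d) (T' : measurableType d') (R : realType)
  (n : nat).
Variables (P : {measure set T -> \bar R}) (y : 'I_n -> T -> T')
  (nu : 'I_n -> probability T' R).
Hypothesis my : forall i, measurable_fun setT (y i).
Hypothesis P_prod : forall B : 'I_n -> set T', (forall i, measurable (B i)) ->
  P [set w | forall i, B i (y i w)] = (\prod_(i < n) nu i (B i))%E.

(** The hypothesis is the case of indicators; the factors are replaced by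
    arbitrary functions one coordinate at a time. *)
Lemma integral_prod_comp (phi : 'I_n -> T' -> R) (J : 'I_n -> R) :
  (forall i, measurable_fun setT (phi i)) -> (forall i x, 0 <= phi i x) ->
  (forall i, (\int[nu i]_x (phi i x)%:E = (J i)%:E)%E) ->
  (\int[P]_w (\prod_(i < n) phi i (y i w))%:E = (\prod_(i < n) J i)%:E)%E.
Proof.
suff H k : forall (phi : 'I_n -> T' -> R) (J : 'I_n -> R),
  (forall i, measurable_fun setT (phi i)) -> (forall i x, 0 <= phi i x) ->
  (forall i, (\int[nu i]_x (phi i x)%:E = (J i)%:E)%E) ->
  (forall i : 'I_n, (k <= i)%N -> exists2 B, measurable B & phi i = \1_B) ->
  (\int[P]_w (\prod_(i < n) phi i (y i w))%:E = (\prod_(i < n) J i)%:E)%E.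
  move=> mphi phi0 phiJ; apply: (H n) => // i.
  by rewrite leqNgt ltn_ord.
elim: k => [|k IH] {}phi {}J mphi phi0 phiJ phiB.
  have /choice[B HB] : forall i, exists B : set T', measurable B /\ phi i = \1_B.
    by move=> i; have [//|B mB ->] := phiB i; exists B.
  have mB i : measurable (B i) by have [] := HB i.
  have phiE i : phi i = \1_(B i) by have [] := HB i.
  have mW : measurable [set w | forall i, B i (y i w)].
    rewrite (_ : [set w | _] = \bigcap_(i in [set: 'I_n]) (y i @^-1` B i)).
      apply: fin_bigcap_measurable => // i _; rewrite -[X in measurable X]setTI.
      exact: my.
    by apply/seteqP; split=> w /= Hw i; move=> *; apply: Hw.
  transitivity (\int[P]_w (\1_[set w | forall i, B i (y i w)] w)%:E)%E.
    apply: eq_integral => w _; congr EFin; rewrite indicE.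
    have [wB|wB] := boolP (w \in _).
      apply: big1 => i _; rewrite phiE indicE mem_set//.
      by move/set_mem: wB; apply.
    have [i Hi] : exists i, ~ B i (y i w).
      by apply/not_existsP => h; move/negP: wB; apply; apply/mem_set => i;
        apply: contrapT; apply: h.
    by rewrite (bigD1 i)//= phiE indicE memNset// mul0r.
  rewrite integral_indic// setIT P_prod// -prodEFin; apply: eq_bigr => i _.
  by rewrite -phiJ phiE integral_indic// setIT.
have [kn|nk] := ltnP k n; last first.
  apply: IH => // i ki; apply: phiB; rewrite (leq_trans _ ki)//.
  by have := leq_ltn_trans (leq_trans nk ki) (ltn_ord i); rewrite ltnn.
pose i0 := Ordinal kn.
have J0 i : 0 <= J i.
  by rewrite -lee_fin -phiJ; apply: integral_ge0 => x _; rewrite lee_fin.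
pose G w := \prod_(i < n | i != i0) phi i (y i w).
transitivity (\int[P]_w (G w * phi i0 (y i0 w))%:E)%E.
  by apply: eq_integral => w _; rewrite (bigD1 i0)//= mulrC.
rewrite (@change_of_law _ _ _ _ _ P (y i0) (nu i0) G (\prod_(i < n | i != i0) J i)) //.
- by rewrite phiJ -EFinM [in RHS](bigD1 i0)//= mulrC.
- rewrite /G; under eq_fun do rewrite -big_filter.
  apply: measurable_prod => i _.
  by apply: measurableT_comp.
- by move=> w; rewrite /G; apply: prodr_ge0 => i _.
move=> B mB.
pose phi' i := if i == i0 then \1_B else phi i.
pose J' i := if i == i0 then fine (nu i0 B) else J i.
transitivity (\int[P]_w (\prod_(i < n) phi' i (y i w))%:E)%E.
  apply: eq_integral => w _; rewrite [in RHS](bigD1 i0)//= mulrC /phi' eqxx.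
  by congr (_ * _)%:E; apply: eq_bigr => i /negbTE ->.
rewrite (IH phi' J').
- rewrite (bigD1 i0)//= /J' eqxx EFinM muleC fineK ?fin_num_measure//.
  by congr (_%:E * _)%E; apply: eq_bigr => i /negbTE ->.
- by move=> i; rewrite /phi'; case: ifP => // _; exact: measurable_indic.
- by move=> i x; rewrite /phi'; case: ifP.
- move=> i; rewrite /phi' /J'; case: ifPn => [/eqP ->|_]; last exact: phiJ.
  by rewrite integral_indic// setIT fineK// fin_num_measure.
- move=> i ki; rewrite /phi'; case: ifPn => [_|ii0]; first by exists B.
  apply: phiB; rewrite ltn_neqAle ki andbT eq_sym.
  by apply: contra ii0 => /eqP h; apply/eqP/val_inj.
Qed.
End product_law.

Section gaussian_mgf.
Context (R : realType).
Implicit Types (m s v x : R).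

Lemma integral_normal_prob m s (phi : R -> R) : measurable_fun setT phi ->
  (forall x, 0 <= phi x) ->
  (\int[normal_prob m s]_x (phi x)%:E =
   \int[lebesgue_measure]_x (normal_pdf m s x * phi x)%:E)%E.
Proof.
move=> mphi phi0.
rewrite (@change_of_law _ _ _ (measurableTypeR R) _ lebesgue_measure id (normal_prob m s)
  (normal_pdf m s) 1)//.
- by rewrite mul1e.
- exact: measurable_normal_pdf.
- by move=> x; exact: normal_pdf_ge0.
move=> B mB; rewrite mul1e /normal_prob [RHS]integral_mkcond.
apply: eq_integral => x _; rewrite patchE indicE.
by case: ifP => _; rewrite ?mulr1 ?mulr0.
Qed.

(** Completing the square: [exp(v (x - m)/s)] times the density is
    [exp(v^2/2)] times the density shifted by [v s]. *)
Lemma normal_prob_mgf m s v : 0 < s ->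
  (\int[normal_prob m s]_x (expR (v * ((x - m) / s)))%:E =
   (expR (v ^+ 2 / 2))%:E)%E.
Proof.
move=> s0; have s0' := lt0r_neq0 s0.
rewrite integral_normal_prob; first last.
- by move=> x; exact: expR_ge0.
- apply: measurableT_comp => //; apply: measurable_funM => //.
  by apply: measurable_funM => //; exact: measurable_funB.
transitivity (\int[lebesgue_measure]_x
   ((expR (v ^+ 2 / 2))%:E * (normal_pdf (m + v * s) s x)%:E))%E.
  apply: eq_integral => x _; rewrite -EFinM; congr EFin.
  rewrite !normal_pdfE// /normal_fun -mulrA [in RHS]mulrCA; congr (_ * _).
  rewrite -!expRD; congr expR; field.
  by rewrite s0'.
rewrite ge0_integralZl//.
- by rewrite integral_normal_pdf mule1.
- by apply/measurable_EFinP; exact: measurable_normal_pdf.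
- by move=> x _; rewrite lee_fin normal_pdf_ge0.
Qed.
End gaussian_mgf.

Definition ip (R : realType) (n : nat) (u v : 'I_n -> R) : R :=
  \sum_(i < n) u i * v i.

(** Standard Gaussian vectors are only used through the moment generating
    function of their linear functionals. *)
Definition white_noise (R : realType) (n : nat) (d : measure_display)
    (T : measurableType d) (P : probability T R) (z : T -> 'I_n -> R) : Prop :=
  (forall i, measurable_fun setT (z ^~ i)) /\
  forall v : 'I_n -> R,
    (\int[P]_w (expR (ip v (z w)))%:E = (expR (ip v v / 2))%:E)%E.

Lemma gaussian_vector_white_noise (R : realType) (n : nat)
    (d : measure_display) (T : measurableType d) (P : probability T R)
    (y : T -> 'rV[R]_n) (theta : 'rV[R]_n) (sigma : R) : 0 < sigma ->
  gaussian_vector P y theta sigma ->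
  white_noise P (fun w i => (y w ord0 i - theta ord0 i) / sigma).
Proof.
move=> s0 [my Py]; split=> [i|v].
  by apply: measurable_funM => //; apply: measurable_funB.
transitivity (\int[P]_w
  (\prod_(i < n) expR (v i * ((y w ord0 i - theta ord0 i) / sigma)))%:E)%E.
  by apply: eq_integral => w _; rewrite /ip expR_sum.
rewrite (@integral_prod_comp _ _ _ (measurableTypeR R) _ _ P (fun i w => y w ord0 i)
   (fun i => normal_prob (theta ord0 i) sigma) my Py
   (fun i x => expR (v i * ((x - theta ord0 i) / sigma)))
   (fun i => expR (v i ^+ 2 / 2))).
- by rewrite -expR_sum /ip mulr_suml; congr (expR _)%:E; apply: eq_bigr => i _;
    rewrite expr2.
- move=> i; apply: measurableT_comp => //; apply: measurable_funM => //.
  by apply: measurable_funM => //; exact: measurable_funB.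
- by move=> i x; exact: expR_ge0.
- by move=> i; exact: normal_prob_mgf.
Qed.

(** * Thresholded squares of a Gaussian and their exponential majorants *)

(** The integral of a nonnegative function is a supremum over simple functions,
    hence monotone on all functions.  It is applied to the loss at an arbitrary
    choice of minimizers, which need not be measurable. *)
Lemma ge0_le_integralT d (T : measurableType d) (R : realType)
    (mu : {measure set T -> \bar R}) (f g : T -> \bar R) :
  (forall x, 0 <= f x)%E -> (forall x, f x <= g x)%E ->
  (\int[mu]_x f x <= \int[mu]_x g x)%E.
Proof.
move=> f0 fg.
have g0 x : (0 <= g x)%E by exact: le_trans (fg x).
rewrite !ge0_integralTE//; apply: le_ereal_sup => _ [h hf <-].
by exists h => // x; exact: le_trans (fg x).
Qed.

Section threshold.
Context (R : realType).
Implicit Types (t k : nat) (x : R).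

Definition thr_slope t k : R := (t + k)%:R.

(** Chosen so that [thr_weight t k * exp(s |x|) >= exp((|x| - t)^2 / 8)], with
    [s = t + k], as soon as [t + k <= |x| <= t + k + 1]. *)
Definition thr_weight t k : R :=
  expR (k.+1%:R ^+ 2 / 8 - thr_slope t k ^+ 2).

Definition thr_term t x k : R :=
  thr_weight t k * (expR (thr_slope t k * x) + expR (- (thr_slope t k * x))).

Definition thr_majorant t x : \bar R :=
  (1 + \sum_(0 <= k <oo) (thr_term t x k)%:E)%E.

Definition excess t x : R := Num.max (`|x| - t%:R) 0.

Lemma thr_term_ge0 t x k : 0 <= thr_term t x k.
Proof. by rewrite mulr_ge0 ?addr_ge0 ?expR_ge0. Qed.

Lemma thr_majorant_ge1 t x : (1 <= thr_majorant t x)%E.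
Proof.
rewrite /thr_majorant leeDl//; apply: nneseries_ge0 => k _ _.
by rewrite lee_fin thr_term_ge0.
Qed.

(** The term with [k] the integer part of [|x| - t] suffices. *)
Lemma excess_le_majorant t x :
  ((expR (excess t x ^+ 2 / 8))%:E <= thr_majorant t x)%E.
Proof.
rewrite /excess; have [xt|tx] := leP `|x| t%:R.
  rewrite max_r ?subr_le0// expr0n/= mul0r expR0.
  exact: thr_majorant_ge1.
have xt0 : 0 <= `|x| - t%:R by rewrite subr_ge0 ltW.
rewrite max_l//; have /andP[kx xk] := truncn_itv xt0.
set k := Num.trunc _ in kx xk.
have nn i : (0 <= (thr_term t x i)%:E)%E by rewrite lee_fin thr_term_ge0.
rewrite /thr_majorant; apply: (@le_trans _ _ (thr_term t x k)%:E); last first.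
  rewrite -[leLHS]add0e; apply: leeD => //.
  apply: le_trans (nneseries_lim_ge k.+1 _) => //.
  by rewrite big_nat_recr//= leeDr// sume_ge0.
rewrite lee_fin /thr_term.
apply: (@le_trans _ _ (thr_weight t k * expR (thr_slope t k * `|x|))).
  rewrite -expRD ler_expR /thr_slope.
  have : (`|x| - t%:R) ^+ 2 <= k.+1%:R ^+ 2 by rewrite lerXn2r ?nnegrE ?ler0n// ltW.
  have : 0 <= (t + k)%:R :> R by [].
  have : (t + k)%:R <= `|x| by rewrite natrD; lra.
  by nra.
rewrite ler_wpM2l ?expR_ge0//.
by have [x0|x0] := ger0P x; rewrite ?mulrN ?lerDl ?lerDr expR_ge0.
Qed.

Lemma sum_geometric_le (a : R) : 0 <= a ->
  (\sum_(0 <= k <oo) (a * (2 / 3) ^+ k)%:E <= (3 * a)%:E)%E.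
Proof.
move=> a0; apply: lime_le.
  apply: is_cvg_nneseries => k _ _.
  by rewrite lee_fin mulr_ge0// exprn_ge0// divr_ge0.
near=> m; rewrite sumEFin lee_fin -mulr_sumr mulrC ler_wpM2r//.
suff -> : \sum_(0 <= i < m) (2 / 3 : R) ^+ i = 3 * (1 - (2 / 3) ^+ m).
  by rewrite ler_piMr// gerBl exprn_ge0// divr_ge0.
elim: {+}m => [|p IH]; first by rewrite big_nil expr0 subrr mulr0.
by rewrite big_nat_recr//= IH exprS; field.
Unshelve. all: by end_near. Qed.

(** The left-hand side is the mean of [thr_majorant t] at a standard Gaussian.
    Its [k]-th term is at most [4 exp(-t^2/2) (2/3)^k], because
    [(k+1)^2/8 - (t+k)^2/2 <= 1/2 - t^2/2 - k/2]. *)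
Lemma thr_mass_le t :
  (1 + \sum_(0 <= k <oo) (2 * thr_weight t k * expR (thr_slope t k ^+ 2 / 2))%:E
   <= (expR (12 * expR (- t%:R ^+ 2 / 2)))%:E)%E.
Proof.
set a := expR (- t%:R ^+ 2 / 2).
have a0 : 0 < a by exact: expR_gt0.
apply: (@le_trans _ _ (1 + 12 * a)%:E); last by rewrite lee_fin expR_ge1Dx.
rewrite EFinD leeD2l// (_ : 12 * a = 3 * (4 * a)); last by ring.
apply: le_trans (sum_geometric_le _); last by rewrite mulr_ge0// ltW.
apply: lee_nneseries => [k _ _|k _].
  by rewrite lee_fin !mulr_ge0 ?expR_ge0.
have e1 : expR (1 / 2) <= 2 :> R.
  have := expR_ge1Dx (- (1 / 2) : R); rewrite expRN.
  have e0 : 0 < expR (1 / 2 : R) by exact: expR_gt0.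
  rewrite -(ler_pM2r e0) mulVf ?gt_eqF//; lra.
have e2 : expR (- (1 / 2)) <= 2 / 3 :> R.
  have e0 : 0 < expR (1 / 2 : R) by exact: expR_gt0.
  rewrite expRN -(ler_pM2r e0) mulVf ?gt_eqF//.
  have := expR_ge1Dx (1 / 2 : R); lra.
rewrite lee_fin -mulrA -expRD.
apply: (@le_trans _ _ (2 * expR (1 / 2 - t%:R ^+ 2 / 2 - k%:R / 2))).
  rewrite ler_pM2l// ler_expR /thr_slope natrD -[k.+1]addn1 natrD.
  have : 0 <= t%:R :> R by []. have : 0 <= k%:R :> R by [].
  have : 0 <= (k%:R - 1) ^+ 2 :> R by rewrite sqr_ge0.
  nra.
rewrite (_ : _ - _ - _ = 1 / 2 + - t%:R ^+ 2 / 2 + (- (1 / 2)) * k%:R); last by field.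
rewrite !expRD -/a expRM_natr.
have q0 : 0 <= expR (- (1 / 2) : R) ^+ k by rewrite exprn_ge0// expR_ge0.
have q1 : expR (- (1 / 2) : R) ^+ k <= (2 / 3) ^+ k.
  by apply: lerXn2r => //; rewrite nnegrE ?expR_ge0// divr_ge0.
rewrite (_ : 4 * a = 2 * (2 * a)); last by ring.
rewrite -[leRHS]mulrA ler_pM2l// ler_pM// ?mulr_ge0 ?expR_ge0//.
by rewrite ler_wpM2r// ltW.
Qed.

End threshold.

(** * Exponential moments along an orthonormal family *)

Section orthonormal_lists.
Context (R : realType) (n : nat).
Implicit Types (u v : 'I_n -> R) (l : seq (nat * ('I_n -> R))).

Lemma ipC u v : ip u v = ip v u.
Proof. by apply: eq_bigr => i _; rewrite mulrC. Qed.

Lemma ipDZl u v x (c : R) : ip (fun i => u i + c * v i) x = ip u x + c * ip v x.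
Proof.
by rewrite /ip mulr_sumr -big_split; apply: eq_bigr => i _; rewrite mulrDl mulrA.
Qed.

Lemma ip_shift_norm u v (c : R) : ip v u = 0 -> ip v v = 1 ->
  ip (fun i => u i + c * v i) (fun i => u i + c * v i) = ip u u + c ^+ 2.
Proof.
move=> vu vv; rewrite ipDZl ipC ipDZl [X in _ + c * X]ipC ipDZl (ipC u v) vu vv.
ring.
Qed.

Definition orthonormal l : bool :=
  pairwise (fun p q => ip p.2 q.2 == 0) l && all (fun p => ip p.2 p.2 == 1) l.

Definition majorant_prod l (z : 'I_n -> R) : \bar R :=
  (\prod_(p <- l) thr_majorant p.1 (ip p.2 z))%E.

Lemma majorant_prod_ge0 l z : (0 <= majorant_prod l z)%E.
Proof.
by rewrite /majorant_prod; apply: prode_ge0 => p _;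
  apply: le_trans (thr_majorant_ge1 _ _).
Qed.

Lemma measurable_ip d (T : measurableType d) (z : T -> 'I_n -> R) v :
  (forall i, measurable_fun setT (z ^~ i)) ->
  measurable_fun setT (fun w => ip v (z w)).
Proof.
move=> mz; apply: measurable_sum => i; exact: measurable_funM.
Qed.

Lemma measurable_thr_term d (T : measurableType d) t k (f : T -> R) :
  measurable_fun setT f -> measurable_fun setT (fun w => thr_term t (f w) k).
Proof.
move=> mf; apply: measurable_funM => //; apply: measurable_funD.
  by apply: measurableT_comp => //; exact: measurable_funM.
by apply: measurableT_comp => //; apply: measurableT_comp => //;
  exact: measurable_funM.
Qed.

Lemma measurable_thr_majorant d (T : measurableType d) t (f : T -> R) :
  measurable_fun setT f -> measurable_fun setT (fun w => thr_majorant t (f w)).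
Proof.
move=> mf; apply: emeasurable_funD => //; apply: ge0_emeasurable_sum.
  by move=> k x _ _; rewrite lee_fin thr_term_ge0.
by move=> k _; apply/measurable_EFinP; exact: measurable_thr_term.
Qed.

Lemma measurable_majorant_prod d (T : measurableType d) (z : T -> 'I_n -> R) l :
  (forall i, measurable_fun setT (z ^~ i)) ->
  measurable_fun setT (fun w => majorant_prod l (z w)).
Proof.
move=> mz; rewrite /majorant_prod; elim: l => [|p l IH].
  by under eq_fun do rewrite big_nil; exact: measurable_cst.
under eq_fun do rewrite big_cons.
by apply: emeasurable_funM => //; apply: measurable_thr_majorant; exact: measurable_ip.
Qed.

Definition log_mass l : R := \sum_(p <- l) 12 * expR (- p.1%:R ^+ 2 / 2).

(** Removing one vector [h] from the family turns the factor [exp <v, z>] into a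
    series of factors [exp <v + s h, z>], whose vectors are orthogonal to the
    remaining ones and satisfy [|v + s h|^2 = |v|^2 + s^2]; the weights of the
    series then recombine into [thr_mass_le].  This replaces the independence of
    the coordinates of [z] in an orthonormal basis. *)
Lemma majorant_prod_mgf d (T : measurableType d) (P : probability T R)
    (z : T -> 'I_n -> R) l : white_noise P z -> orthonormal l ->
  forall v, all (fun p => ip p.2 v == 0) l ->
  (\int[P]_w ((expR (ip v (z w)))%:E * majorant_prod l (z w)) <=
   (expR (ip v v / 2 + log_mass l))%:E)%E.
Proof.
move=> [mz mgf]; elim: l => [_ v _|[t h] l IH].
  rewrite /majorant_prod /log_mass big_nil addr0 -mgf.
  by under eq_integral do rewrite big_nil mule1.
rewrite /orthonormal/= => /andP[/andP[hl ol] /andP[/eqP hh nl]] v /andP[/eqP hv lv].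
have {}IH u : all (fun p => ip p.2 u == 0) l ->
  (\int[P]_w ((expR (ip u (z w)))%:E * majorant_prod l (z w)) <=
   (expR (ip u u / 2 + log_mass l))%:E)%E.
  by apply: IH; rewrite /orthonormal ol nl.
pose sh (c : R) := fun i => v i + c * h i.
have shl c : all (fun p => ip p.2 (sh c) == 0) l.
  apply/allP => p pl; rewrite ipC ipDZl ![ip _ p.2]ipC.
  move/allP: lv => /(_ p pl)/eqP ->.
  by rewrite ipC; move/allP: hl => /(_ p pl)/eqP ->; rewrite mulr0 addr0.
pose F c w := ((expR (ip (sh c) (z w)))%:E * majorant_prod l (z w))%E.
have mF c : measurable_fun setT (F c).
  apply: emeasurable_funM; last exact: measurable_majorant_prod.
  by apply/measurable_EFinP; apply: measurableT_comp => //; exact: measurable_ip.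
have F0 c w : (0 <= F c w)%E.
  by rewrite mule_ge0 ?majorant_prod_ge0// lee_fin expR_ge0.
have intF c : (\int[P]_w F c w <=
    (expR (c ^+ 2 / 2) * expR (ip v v / 2 + log_mass l))%:E)%E.
  apply: (le_trans (IH _ (shl c))).
  rewrite /sh ip_shift_norm// lee_fin -expRD.
  rewrite (_ : _ + log_mass l = c ^+ 2 / 2 + (ip v v / 2 + log_mass l))//.
  by ring.
pose s k : R := thr_slope R t k.
pose c k : R := thr_weight R t k.
have c0 k : 0 <= c k by exact: expR_ge0.
pose B k w := ((c k)%:E * (F (s k) w + F (- s k)%R w))%E.
have B0 k w : (0 <= B k w)%E by rewrite mule_ge0 ?adde_ge0// lee_fin.
have mB k : measurable_fun setT (B k).
  by apply: measurable_funeM; exact: emeasurable_funD.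
apply: (@le_trans _ _ (\int[P]_w (F 0%R w + \sum_(0 <= k <oo) B k w))%E).
  apply: ge0_le_integralT => w.
    by rewrite mule_ge0 ?majorant_prod_ge0// lee_fin expR_ge0.
  rewrite /majorant_prod big_cons -/(majorant_prod l (z w)) /=.
  have F0E : F 0 w = ((expR (ip v (z w)))%:E * majorant_prod l (z w))%E.
    by rewrite /F ipDZl mul0r addr0.
  (* The series distributes over a finite factor only. *)
  have [Goo|Gfin] := eqVneq (majorant_prod l (z w)) +oo%E.
    rewrite (_ : F 0 w = +oo%E) ?addye ?leey//.
      by rewrite gt_eqF// (lt_le_trans _ (nneseries_ge0 _))// ltNyr.
    by rewrite F0E Goo gt0_muley// lte_fin expR_gt0.
  have Gf : majorant_prod l (z w) \is a fin_num.
    by rewrite ge0_fin_numE ?majorant_prod_ge0// ltey.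
  have [g GE] : exists g, majorant_prod l (z w) = g%:E.
    by exists (fine (majorant_prod l (z w))); rewrite fineK.
  have g0 : 0 <= g by rewrite -lee_fin -GE majorant_prod_ge0.
  rewrite /thr_majorant muleA ge0_muleDr//; last first.
    by apply: nneseries_ge0 => k _ _; rewrite lee_fin thr_term_ge0.
  rewrite mule1 ge0_muleDl ?F0E; last 2 first.
  - by rewrite lee_fin expR_ge0.
  - rewrite mule_ge0 ?lee_fin ?expR_ge0//.
    by apply: nneseries_ge0 => k _ _; rewrite lee_fin thr_term_ge0.
  rewrite leeD2l// GE muleAC -EFinM -nneseriesZl; last first.
    by move=> k _; rewrite lee_fin thr_term_ge0.
  apply: lee_nneseries => [k _ _|k _].
    rewrite lee_fin; apply: mulr_ge0; last exact: thr_term_ge0.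
    by apply: mulr_ge0 => //; exact: expR_ge0.
  rewrite /B /F GE -!EFinM lee_fin.
  rewrite !ipDZl !expRD /thr_term -/(s k) -/(c k) mulNr le_eqVlt; apply/orP; left.
  by apply/eqP; ring.
rewrite ge0_integralD//; last 2 first.
- by move=> w _; apply: nneseries_ge0.
- by apply: ge0_emeasurable_sum.
rewrite integral_nneseries//.
set K := expR (ip v v / 2 + log_mass l) in intF.
have K0 : 0 <= K by exact: expR_ge0.
rewrite /log_mass big_cons/= addrCA expRD mulrC EFinM.
apply: (@le_trans _ _ (K%:E * (1 + \sum_(0 <= k <oo)
   (2 * thr_weight R t k * expR (thr_slope R t k ^+ 2 / 2))%:E))%E); last first.
  by rewrite muleC [leRHS]muleC; apply: lee_wpmul2r; rewrite ?lee_fin// thr_mass_le.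
rewrite ge0_muleDr//; last first.
  by apply: nneseries_ge0 => k _ _; rewrite lee_fin !mulr_ge0 ?expR_ge0.
rewrite mule1; apply: leeD.
  by have := intF 0; rewrite expr0n/= mul0r expR0 mul1r.
rewrite -nneseriesZl; last by move=> k _; rewrite lee_fin !mulr_ge0 ?expR_ge0.
apply: lee_nneseries => [k _ _|k _]; first exact: integral_ge0.
rewrite ge0_integralZl//; last 3 first.
- exact: emeasurable_funD.
- by move=> w _; rewrite adde_ge0.
- by rewrite lee_fin.
rewrite ge0_integralD//.
apply: (@le_trans _ _ ((c k)%:E * ((expR (s k ^+ 2 / 2) * K)%:E
   + (expR (s k ^+ 2 / 2) * K)%:E))%E).
  apply: lee_pmul => //; [by rewrite lee_fin | by apply: adde_ge0; apply: integral_ge0 |].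
  by apply: leeD => //; have := intF (- s k); rewrite sqrrN.
rewrite -EFinD -!EFinM lee_fin -/(c k) -/(s k) le_eqVlt; apply/orP; left.
by apply/eqP; ring.
Qed.

End orthonormal_lists.

(** * Total variation and the Haar tree of a block *)

Section total_variation.
Context (R : realType).
Implicit Types (s : seq R) (x y : R).

Lemma tv_nil : tv [::] = 0 :> R.
Proof. by rewrite /tv big_geq. Qed.

Lemma tv1 x : tv [:: x] = 0.
Proof. by rewrite /tv big_geq. Qed.

Lemma tv_cons x y s : tv [:: x, y & s] = `|x - y| + tv (y :: s).
Proof. by rewrite /tv /= big_nat_recl. Qed.

Lemma tv_ge0 s : 0 <= tv s.
Proof. by apply: sumr_ge0. Qed.

Lemma tv_cons_ge x s : tv s <= tv (x :: s).
Proof.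
by case: s => [|y s]; rewrite ?tv1 ?tv_nil// tv_cons lerDr.
Qed.

Lemma tv_cat s1 s2 : tv s1 + tv s2 <= tv (s1 ++ s2).
Proof.
elim: s1 => [|x [|y s1] IH]; rewrite ?tv_nil ?add0r//.
  by rewrite tv1 add0r tv_cons_ge.
by rewrite /= !tv_cons -addrA lerD2l.
Qed.

Lemma dist_le_tv s x y : x \in s -> y \in s -> `|x - y| <= tv s.
Proof.
suff H : forall s x z, z \in x :: s -> `|x - z| <= tv (x :: s).
  elim: s => [//|a s IH]; rewrite !inE.
  move=> /predU1P[->|xs] /predU1P[->|ys].
  - by rewrite subrr normr0 tv_ge0.
  - by apply: H; rewrite inE ys orbT.
  - by rewrite distrC; apply: H; rewrite inE xs orbT.
  - by apply: le_trans (tv_cons_ge _ _); exact: IH.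
move=> {}s; elim: s => [|b s IH] {}x z.
  by rewrite inE => /eqP ->; rewrite subrr normr0 tv1.
rewrite inE => /predU1P[->|zs]; first by rewrite subrr normr0 tv_ge0.
rewrite tv_cons (le_trans (ler_distD b _ _))// lerD2l; exact: IH.
Qed.

Lemma tv_map_sub (I : Type) (u v : I -> R) (s : seq I) :
  tv [seq u i - v i | i <- s] <= tv (map u s) + tv (map v s).
Proof.
elim: s => [|i [|j s] IH]; rewrite /= ?tv_nil ?tv1 ?addr0//.
rewrite !tv_cons addrACA lerD// .
rewrite (_ : _ - _ = (u i - u j) - (v i - v j)); last by ring.
exact: ler_normB.
Qed.
End total_variation.

Section haar_tree.
Context (R : realType) (n : nat).
Implicit Types (s : seq 'I_n) (f g z : 'I_n -> R) (k J r : nat).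

(** The normalized Haar vector of a split into possibly unequal parts: constant
    on each part, of sum zero, and of Euclidean norm one. *)
Definition haar s1 s2 : 'I_n -> R := fun i =>
  Num.sqrt ((size s1)%:R * (size s2)%:R / (size s1 + size s2)%:R) *
  ((i \in s1)%:R / (size s1)%:R - (i \in s2)%:R / (size s2)%:R).

(** Haar vectors of the successive halvings of [s], each with its threshold [2 r].
    The counter [J] decreases along the coarse depths, where [r] stays [0]; below
    them [r] increases by one at each depth.  The first argument is fuel. *)
Fixpoint nodes k J r s : seq (nat * ('I_n -> R)) :=
  if k is k'.+1 then
    if (size s <= 1)%N then [::] else
    let s1 := take (size s)./2 s in let s2 := drop (size s)./2 s in
    let r' := if J == 0%N then r.+1 else r in
    ((2 * r)%N, haar s1 s2) :: nodes k' J.-1 r' s1 ++ nodes k' J.-1 r' s2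
  else [::].

Definition flat s : 'I_n -> R := fun i => (i \in s)%:R / Num.sqrt (size s)%:R.

Definition block_nodes J s := (0%N, flat s) :: nodes (size s) J 0 s.

(** A level that exceeds the depth of the tree makes all nodes coarse.  Hence
    levels up to [n] suffice and the union bound is over a finite set. *)
Lemma nodes_cap k J J' r s : (k <= J)%N -> (k <= J')%N ->
  nodes k J r s = nodes k J' r s.
Proof.
elim: k J J' s => //= k IH [|J] [|J'] s //= kJ kJ'.
by case: ifP => // _; rewrite (IH J J') // (IH J J').
Qed.

Lemma sum_mem s f : uniq s -> \sum_i (i \in s)%:R * f i = \sum_(i <- s) f i.
Proof.
move=> us; rewrite [RHS]big_uniq//= [RHS]big_mkcond; apply: eq_bigr => i _.
by case: (i \in s); rewrite ?mul1r ?mul0r.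
Qed.

Lemma ip_haar s1 s2 f : uniq s1 -> uniq s2 -> ip (haar s1 s2) f =
  Num.sqrt ((size s1)%:R * (size s2)%:R / (size s1 + size s2)%:R) *
  ((\sum_(i <- s1) f i) / (size s1)%:R - (\sum_(i <- s2) f i) / (size s2)%:R).
Proof.
move=> u1 u2; rewrite /ip /haar -(sum_mem _ u1) -(sum_mem _ u2) !mulr_suml -sumrB mulr_sumr.
by apply: eq_bigr => i _; ring.
Qed.

Lemma ip_flat s f : uniq s ->
  ip (flat s) f = (\sum_(i <- s) f i) / Num.sqrt (size s)%:R.
Proof.
move=> us; rewrite /ip /flat -(sum_mem _ us) mulr_suml.
by apply: eq_bigr => i _; rewrite mulrAC.
Qed.

Lemma nodes_support k J r s p i :
  p \in nodes k J r s -> i \notin s -> p.2 i = 0.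
Proof.
elim: k J r s => //= k IH J r s; case: ifP => // _.
set m := (size s)./2.
rewrite inE mem_cat => /or3P[/eqP -> /=| pi | pi] ni.
- rewrite /haar; move: ni; rewrite -{1}(cat_take_drop m s) mem_cat negb_or.
  by move=> /andP[/negbTE -> /negbTE ->]; rewrite !mul0r subrr mulr0.
- by apply: (IH _ _ _ pi); apply: contra ni; exact: mem_take.
- by apply: (IH _ _ _ pi); apply: contra ni; exact: mem_drop.
Qed.

Lemma sum_cst s f (c : R) : (forall i, i \in s -> f i = c) ->
  \sum_(i <- s) f i = c * (size s)%:R.
Proof.
move=> fc; rewrite (eq_big_seq (fun=> c)) => [|i /fc //].
by rewrite big_const_seq count_predT iter_addr_0 mulr_natr.
Qed.

(** A node of the tree of [s] sums to zero and is supported in [s]. *)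
Lemma nodes_cst k J r s p f (c : R) : uniq s ->
  p \in nodes k J r s -> (forall i, i \in s -> f i = c) -> ip p.2 f = 0.
Proof.
elim: k J r s => //= k IH J r s us; case: ifPn => //; rewrite -ltnNge => s2.
set m := (size s)./2.
have [u1 u2] : uniq (take m s) /\ uniq (drop m s).
  by rewrite take_uniq ?drop_uniq.
have m0 : (0 < m)%N by rewrite half_gt0.
have ms : (m < size s)%N by rewrite /m; lia.
rewrite inE mem_cat => /or3P[/eqP -> /=| pi | pi] fc.
- rewrite ip_haar// !(@sum_cst _ _ c); last 2 first.
  + by move=> i /mem_drop; apply: fc.
  + by move=> i /mem_take; apply: fc.
  rewrite !mulfK ?subrr ?mulr0// pnatr_eq0.
    by rewrite size_drop subn_eq0 -ltnNge.
  by rewrite size_take ms -lt0n.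
- by apply: (IH _ _ _ _ pi) => // i /mem_take; apply: fc.
- by apply: (IH _ _ _ _ pi) => // i /mem_drop; apply: fc.
Qed.

Lemma half_split s : (1 < size s)%N ->
  [/\ size (take (size s)./2 s) = (size s)./2,
      size (drop (size s)./2 s) = (size s - (size s)./2)%N,
      (0 < (size s)./2)%N & (0 < size s - (size s)./2)%N].
Proof.
move=> s2; rewrite size_drop size_take; split => //; [case: ifP => //| |]; lia.
Qed.

Lemma ip_haar_self s1 s2 : uniq (s1 ++ s2) -> (0 < size s1)%N -> (0 < size s2)%N ->
  ip (haar s1 s2) (haar s1 s2) = 1.
Proof.
rewrite cat_uniq => /and3P[u1 /hasPn dis u2] n1 n2.
rewrite ip_haar//.
set a := Num.sqrt _.
have N1 : (size s1)%:R != 0 :> R by rewrite pnatr_eq0 -lt0n.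
have N2 : (size s2)%:R != 0 :> R by rewrite pnatr_eq0 -lt0n.
have N12 : (size s1)%:R + (size s2)%:R != 0 :> R.
  by rewrite -natrD pnatr_eq0 addn_eq0 negb_and -lt0n n1.
rewrite (@sum_cst s1 _ (a / (size s1)%:R)); last first.
  move=> i i1; rewrite /haar -/a i1 mul1r.
  have /negbTE -> : i \notin s2 by apply/negP => /dis; rewrite i1.
  by rewrite mul0r subr0.
rewrite (@sum_cst s2 _ (- a / (size s2)%:R)); last first.
  move=> i i2; rewrite /haar -/a i2 mul1r (negbTE (dis _ i2)).
  by rewrite mul0r sub0r mulrN mulNr.
have aa : a * a = (size s1)%:R * (size s2)%:R / ((size s1)%:R + (size s2)%:R).
  by rewrite -expr2 sqr_sqrtr natrD// divr_ge0// ?mulr_ge0// addr_ge0.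
rewrite !mulfK// mulNr opprK -mulrDr mulrA aa; field.
by rewrite N1 N2 N12.
Qed.

Lemma orthonormal_cat (l1 l2 : seq (nat * ('I_n -> R))) :
  orthonormal (l1 ++ l2) = [&& orthonormal l1, orthonormal l2 &
    allrel (fun p q => ip p.2 q.2 == 0) l1 l2].
Proof.
rewrite /orthonormal pairwise_cat all_cat.
by case: allrel; case: (pairwise _ l1); case: (pairwise _ l2);
  case: (all _ l1); case: (all _ l2).
Qed.

Lemma disjoint_ip s1 s2 f g : ~~ has (mem s1) s2 ->
  (forall i, i \notin s1 -> f i = 0) -> (forall i, i \notin s2 -> g i = 0) ->
  ip f g = 0.
Proof.
move=> /hasPn dis f0 g0; apply: big1 => i _.
have [i1|/f0 ->] := boolP (i \in s1); last by rewrite mul0r.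
by rewrite g0 ?mulr0//; apply/negP => /dis; rewrite /= i1.
Qed.

Lemma nodes_orthonormal k J r s : uniq s -> orthonormal (nodes k J r s).
Proof.
elim: k J r s => //= k IH J r s us; case: ifPn => //; rewrite -ltnNge => s2.
have [z1 z2 m0 m1] := half_split s2.
set m := (size s)./2 in z1 z2 m0 m1 *.
have ucat : uniq (take m s ++ drop m s) by rewrite cat_take_drop.
have /and3P[u1 dis u2] : [&& uniq (take m s), ~~ has (mem (take m s)) (drop m s)
   & uniq (drop m s)] by rewrite -cat_uniq.
rewrite -cat1s orthonormal_cat orthonormal_cat !IH//=.
rewrite {1}/orthonormal/= ip_haar_self ?z1 ?z2// eqxx/=.
apply/andP; split.
  apply/allrelP => p q pi qi; apply/eqP.
  by apply: (disjoint_ip dis) => i; [exact: (nodes_support pi)|exact: (nodes_support qi)].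
rewrite /allrel/= andbT all_cat; apply/andP; split; apply/allP => p pi;
    apply/eqP; rewrite ipC.
  apply: (nodes_cst (c := Num.sqrt ((size (take m s))%:R * (size (drop m s))%:R
    / (size (take m s) + size (drop m s))%:R) / (size (take m s))%:R) u1 pi).
  move=> i i1; rewrite /haar i1 mul1r.
  have /negbTE -> : i \notin drop m s.
    by apply/negP => i2; move/hasPn: dis => /(_ _ i2); rewrite /= i1.
  by rewrite mul0r subr0.
apply: (nodes_cst (c := - (Num.sqrt ((size (take m s))%:R * (size (drop m s))%:R
    / (size (take m s) + size (drop m s))%:R) / (size (drop m s))%:R)) u2 pi).
move=> i i2; rewrite /haar i2 mul1r.
have /negbTE -> : i \notin take m s.
  by move/hasPn: dis => /(_ _ i2).
by rewrite mul0r sub0r mulrN.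
Qed.

End haar_tree.

(** * Parseval identity, bias and mass of a Haar tree *)

Section tree_estimates.
Context (R : realType) (n : nat).
Implicit Types (s : seq 'I_n) (f g z : 'I_n -> R) (k J r : nat).

Lemma nodes_parseval k J r s f g : uniq s -> (size s <= k)%N ->
  \sum_(p <- nodes R k J r s) ip p.2 f * ip p.2 g =
  \sum_(i <- s) f i * g i
    - (\sum_(i <- s) f i) * (\sum_(i <- s) g i) / (size s)%:R.
Proof.
elim: k J r s => [|k IH] J r s us /=.
  by case: s us => //= _ _; rewrite !big_nil mul0r mul0r subrr.
case: ifPn => [s1 _|].
  case: s us s1 => [|x []]//= _ _; rewrite ?big_nil ?big_seq1.
    by rewrite mul0r mul0r subrr.
  by rewrite divr1 subrr.
rewrite -ltnNge => s2 sk.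
have [z1 z2 m0 m1] := half_split s2.
set m := (size s)./2 in z1 z2 m0 m1 *.
have [u1 u2] : uniq (take m s) /\ uniq (drop m s).
  by rewrite take_uniq ?drop_uniq.
rewrite big_cons big_cat/= !IH// ?z1 ?z2; [|lia|lia].
rewrite !ip_haar// z1 z2.
rewrite -[X in _ = \sum_(i <- X) _ - (\sum_(i <- X) _) * (\sum_(i <- X) _) / _](cat_take_drop m s) !big_cat/=.
have -> : (m + (size s - m))%N = size s by lia.
set F1 := \sum_(i <- take m s) f i; set F2 := \sum_(i <- drop m s) f i.
set G1 := \sum_(i <- take m s) g i; set G2 := \sum_(i <- drop m s) g i.
set N1 := m%:R; set N2 := (size s - m)%:R.
have -> : (size s)%:R = N1 + N2 :> R by rewrite -natrD; congr (_%:R); lia.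
have N10 : 0 < N1 :> R by rewrite ltr0n.
have N20 : 0 < N2 :> R by rewrite ltr0n.
set a := Num.sqrt _.
have aa : a * a = N1 * N2 / (N1 + N2).
  by rewrite -expr2 sqr_sqrtr// divr_ge0 ?mulr_ge0 ?addr_ge0 ?ltW.
rewrite (_ : a * _ * (a * _) = (a * a) * ((F1 / N1 - F2 / N2) * (G1 / N1 - G2 / N2)));
  last by ring.
rewrite aa; field.
by rewrite !gt_eqF// addr_gt0.
Qed.

Lemma block_parseval J s f g : uniq s -> (0 < size s)%N ->
  \sum_(p <- block_nodes R J s) ip p.2 f * ip p.2 g = \sum_(i <- s) f i * g i.
Proof.
move=> us s0; rewrite /block_nodes big_cons nodes_parseval//= !ip_flat//.
set N : R := (size s)%:R.
have N0 : 0 < N by rewrite ltr0n.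
have NN : Num.sqrt N * Num.sqrt N = N by rewrite -expr2 sqr_sqrtr// ltW.
rewrite mulrACA -invfM NN; ring.
Qed.

Lemma norm_sum_le (I : eqType) (t : seq I) (F : I -> R) (c : R) :
  (forall i, i \in t -> `|F i| <= c) -> `|\sum_(i <- t) F i| <= c * (size t)%:R.
Proof.
move=> Fc; rewrite big_seq; apply: le_trans (ler_norm_sum _ _ _) _.
apply: (@le_trans _ _ (\sum_(i <- t | i \in t) c)); first exact: ler_sum.
by rewrite -big_seq big_const_seq count_predT iter_addr_0 mulr_natr.
Qed.

(** The coefficient is [sqrt(N1 N2 / (N1 + N2))] times a difference of two means,
    and [N1 N2 <= (N1 + N2) (N1 + N2 - 1)].  Unlike [N], the factor [N - 1] is at
    least halved in both parts of an uneven split. *)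
Lemma haar_coef_le s1 s2 g : uniq s1 -> uniq s2 ->
  (0 < size s1)%N -> (0 < size s2)%N ->
  `|ip (haar R s1 s2) g| <=
  Num.sqrt (size s1 + size s2).-1%:R * tv (map g (s1 ++ s2)).
Proof.
move=> u1 u2 n1 n2; rewrite ip_haar// normrM.
set N1 : R := (size s1)%:R; set N2 : R := (size s2)%:R.
have N10 : 1 <= N1 by rewrite ler1n.
have N20 : 1 <= N2 by rewrite ler1n.
apply: ler_pM => //.
  rewrite ger0_norm ?sqrtr_ge0// ler_wsqrtr//.
  rewrite -subn1 natrB ?addn_gt0 ?n1// natrD -/N1 -/N2 ler_pdivrMr; last by lra.
  by nra.
have -> : (\sum_(i <- s1) g i) / N1 - (\sum_(i <- s2) g i) / N2 =
    (\sum_(i <- s1) \sum_(j <- s2) (g i - g j)) / (N1 * N2).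
  rewrite [in RHS](eq_bigr (fun i => g i * N2 - \sum_(j <- s2) g j)); last first.
    by move=> i _; rewrite sumrB (@sum_cst _ _ s2 (fun=> g i) (g i))//.
  rewrite sumrB -mulr_suml (@sum_cst _ _ s1 (fun=> \sum_(j <- s2) g j) (\sum_(j <- s2) g j))//.
  rewrite -/N1; field.
  by rewrite !gt_eqF//; lra.
rewrite normrM normfV (ger0_norm (_ : 0 <= N1 * N2)); last by nra.
rewrite ler_pdivrMr; last by nra.
rewrite (mulrC N1) mulrA; apply: norm_sum_le => i i1.
apply: norm_sum_le => j j2; apply: dist_le_tv; apply: map_f.
  by rewrite mem_cat i1.
by rewrite mem_cat j2 orbT.
Qed.

Lemma sqrt_half_le (x y : R) : 0 <= y -> 2 * x <= y ->
  Num.sqrt x <= 3 / 4 * Num.sqrt y.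
Proof.
move=> y0 xy; rewrite (_ : 3 / 4 = Num.sqrt ((3 / 4) ^+ 2)); last first.
  by rewrite sqrtr_sqr ger0_norm// divr_ge0.
rewrite -sqrtrM ?sqr_ge0//; apply: ler_wsqrtr; lra.
Qed.

Definition threshold_cost (l : seq (nat * ('I_n -> R))) g : R :=
  \sum_(p <- l) p.1%:R * `|ip p.2 g|.

(** The affine factor solves [c_r = 2r + (3/4) c_(r+1)], where [3/4] bounds the
    ratio [1/sqrt 2] of the costs of consecutive depths. *)
Lemma fine_cost k r s g : uniq s ->
  threshold_cost (nodes R k 0 r s) g <=
  (8 * r%:R + 24) * (Num.sqrt (size s).-1%:R * tv (map g s)).
Proof.
have rhs0 q t : 0 <= (8 * q%:R + 24) * (Num.sqrt (size t).-1%:R * tv (map g t)).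
  by rewrite !mulr_ge0 ?addr_ge0 ?mulr_ge0 ?sqrtr_ge0 ?tv_ge0.
elim: k r s => [|k IH] r s us /=; first by rewrite /threshold_cost big_nil.
case: ifPn => [_|]; first by rewrite /threshold_cost big_nil.
rewrite -ltnNge => s2.
have [z1 z2 m0 m1] := half_split s2.
set m := (size s)./2 in z1 z2 m0 m1 *.
have [u1 u2] : uniq (take m s) /\ uniq (drop m s).
  by rewrite take_uniq ?drop_uniq.
rewrite /threshold_cost big_cons big_cat/=.
set W := tv (map g s); set q := Num.sqrt (size s).-1%:R.
have W12 : tv (map g (take m s)) + tv (map g (drop m s)) <= W.
  by rewrite -[X in _ <= tv (map g X)](cat_take_drop m s) map_cat tv_cat.
have root : `|ip (haar R (take m s) (drop m s)) g| <= q * W.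
  have := @haar_coef_le (take m s) (drop m s) g u1 u2; rewrite z1 z2 => /(_ m0 m1).
  by rewrite cat_take_drop (_ : (m + _)%N = size s)//; lia.
have q0 : 0 <= q by exact: sqrtr_ge0.
have half t : (2 * (size t).-1 <= (size s).-1)%N ->
    Num.sqrt (size t).-1%:R <= 3 / 4 * q.
  by move=> ts; apply: sqrt_half_le => //; rewrite -natrM ler_nat.
have h1 := IH r.+1 _ u1; have h2 := IH r.+1 _ u2.
have q1 : Num.sqrt (size (take m s)).-1%:R <= 3 / 4 * q.
  by apply: half; rewrite z1 /m; lia.
have q2 : Num.sqrt (size (drop m s)).-1%:R <= 3 / 4 * q.
  by apply: half; rewrite z2 /m; lia.
move: h1 h2; rewrite /threshold_cost.
set A1 := \sum_(p <- _) _; set A2 := \sum_(p <- nodes _ _ _ _ (drop m s)) _.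
set W1 := tv _ in W12 *; set W2 := tv (map g (drop m s)) in W12 *.
have W10 : 0 <= W1 by exact: tv_ge0.
have W20 : 0 <= W2 by exact: tv_ge0.
have -> : r.+1%:R = r%:R + 1 :> R by rewrite -addn1 natrD.
rewrite natrM; set rr : R := r%:R; have rr0 : 0 <= rr by [].
move=> h1 h2.
have {}h1 : A1 <= (8 * (rr + 1) + 24) * (3 / 4 * q * W1).
  by apply: le_trans h1 _; rewrite ler_wpM2l ?ler_wpM2r//; lra.
have {}h2 : A2 <= (8 * (rr + 1) + 24) * (3 / 4 * q * W2).
  by apply: le_trans h2 _; rewrite ler_wpM2l ?ler_wpM2r//; lra.
have h3 : 2 * rr * `|ip (haar R (take m s) (drop m s)) g| <= 2 * rr * (q * W).
  by rewrite ler_wpM2l// mulr_ge0.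
have h4 : (8 * (rr + 1) + 24) * (3 / 4 * q * (W1 + W2)) <=
          (8 * (rr + 1) + 24) * (3 / 4 * q * W).
  by rewrite ler_wpM2l ?ler_wpM2l// ?mulr_ge0//; lra.
lra.
Qed.

(** Coarse nodes have threshold [0]; each coarse depth divides [N - 1] by two and
    preserves the sum of the variations. *)
Lemma coarse_cost k J s g : uniq s ->
  threshold_cost (nodes R k J 0 s) g <=
  24 * (Num.sqrt ((size s).-1%:R / 2 ^+ J) * tv (map g s)).
Proof.
elim: J k s => [|J IH] k s us.
  by rewrite expr0 divr1; have := fine_cost k 0 g us; rewrite mulr0 add0r.
have rhs0 : 0 <= 24 * (Num.sqrt ((size s).-1%:R / 2 ^+ J.+1) * tv (map g s)).
  by rewrite !mulr_ge0 ?sqrtr_ge0 ?tv_ge0.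
case: k => [|k] /=; first by rewrite /threshold_cost big_nil.
case: ifPn => [_|]; first by rewrite /threshold_cost big_nil.
rewrite -ltnNge => s2.
have [z1 z2 m0 m1] := half_split s2.
set m := (size s)./2 in z1 z2 m0 m1 *.
have [u1 u2] : uniq (take m s) /\ uniq (drop m s).
  by rewrite take_uniq ?drop_uniq.
rewrite /threshold_cost big_cons big_cat/= muln0 mul0r add0r.
have W12 : tv (map g (take m s)) + tv (map g (drop m s)) <= tv (map g s).
  by rewrite -[X in _ <= tv (map g X)](cat_take_drop m s) map_cat tv_cat.
have h1 := IH k _ u1; have h2 := IH k _ u2.
set q := Num.sqrt _ in rhs0 *.
have half t : (2 * (size t).-1 <= (size s).-1)%N ->
    Num.sqrt ((size t).-1%:R / 2 ^+ J) <= q.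
  move=> ts; apply: ler_wsqrtr.
  rewrite exprS invfM mulrA ler_pM2r ?invr_gt0 ?exprn_gt0//.
  by rewrite ler_pdivlMr// -natrM ler_nat mulnC.
apply: (@le_trans _ _ (24 * (q * tv (map g (take m s))) + 24 * (q * tv (map g (drop m s))))).
  apply: lerD.
    apply: (le_trans h1); rewrite ler_wpM2l// ler_wpM2r ?tv_ge0//.
    by apply: half; rewrite z1 /m; lia.
  apply: (le_trans h2); rewrite ler_wpM2l// ler_wpM2r ?tv_ge0//.
  by apply: half; rewrite z2 /m; lia.
by rewrite -!mulrDr ler_wpM2l// ler_wpM2l// sqrtr_ge0.
Qed.

(** The bound [b_r = 24 / 4^r] satisfies [12 exp(-2 r^2) + 2 b_(r+1) <= b_r]. *)
Lemma fine_mass k r s :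
  log_mass (nodes R k 0 r s) <= 24 / 4 ^+ r.
Proof.
have p0 q : 0 < 4 ^+ q :> R by rewrite exprn_gt0.
elim: k r s => [|k IH] r s /=; first by rewrite /log_mass big_nil divr_ge0// ltW.
case: ifPn => [_|_]; first by rewrite /log_mass big_nil divr_ge0// ltW.
rewrite /log_mass big_cons big_cat/= -/(log_mass _) -/(log_mass _).
have h1 := IH r.+1 (take (size s)./2 s); have h2 := IH r.+1 (drop (size s)./2 s).
have e4 : expR (- (2 * r)%:R ^+ 2 / 2) <= (4 ^+ r)^-1 :> R.
  rewrite mulNr expRN lef_pV2 ?posrE ?expR_gt0// ?p0//.
  apply: (@le_trans _ _ (expR (2 * r%:R))); last first.
    rewrite ler_expR natrM.
    have : r%:R <= r%:R ^+ 2 :> R by rewrite -natrX ler_nat; nia.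
    lra.
  rewrite mulrC expRM_natl// (_ : 4 = 2 ^+ 2 :> R); last by ring.
  have e1 : 2 <= expR 1 :> R by have := expR_ge1Dx (1 : R); lra.
  rewrite -exprM mulnC exprM (_ : expR 2 = expR 1 ^+ 2); last first.
    by rewrite expr2 -expRD; congr expR; lra.
  rewrite -!exprM mulnC.
  by apply: lerXn2r => //; rewrite nnegrE ?expR_ge0.
rewrite exprS invfM in h1 h2; lra.
Qed.

Lemma block_mass J s : log_mass (block_nodes R J s) <= 36 * 2 ^+ J.
Proof.
suff H k : log_mass (nodes R k J 0 s) <= 36 * 2 ^+ J - 12.
  rewrite /block_nodes /log_mass big_cons -/(log_mass _)/=.
  by rewrite expr0n/= oppr0 mul0r expR0; have := H (size s); lra.
elim: J k s => [|J IH] k s.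
  by have := fine_mass k 0 s; rewrite !expr0 divr1; lra.
have J1 : 1 <= 2 ^+ J :> R by rewrite exprn_ege1// ler1n.
have rhs0 : 0 <= 36 * 2 ^+ J.+1 - 12 :> R by rewrite exprS; lra.
case: k => [|k] /=; first by rewrite /log_mass big_nil.
case: ifPn => [_|_]; first by rewrite /log_mass big_nil.
rewrite /log_mass big_cons big_cat/= -/(log_mass _) -/(log_mass _) muln0.
have h1 := IH k (take (size s)./2 s); have h2 := IH k (drop (size s)./2 s).
rewrite expr0n/= oppr0 mul0r expR0 exprS; lra.
Qed.

End tree_estimates.

(** * Families of disjoint blocks *)

Section block_structures.
Context (R : realType) (n : nat).
Implicit Types (s : seq 'I_n) (f g z : 'I_n -> R) (bl : seq (nat * seq 'I_n)).

Definition block_family_nodes bl : seq (nat * ('I_n -> R)) :=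
  flatten [seq block_nodes R b.1 b.2 | b <- bl].

Definition block_family bl : bool :=
  uniq (flatten [seq b.2 | b <- bl]) && all (fun b => 0 < size b.2)%N bl.

Definition energy (l : seq (nat * ('I_n -> R))) z : R :=
  \sum_(p <- l) excess p.1 (ip p.2 z) ^+ 2.

Lemma block_nodes_support J s p i :
  p \in block_nodes R J s -> i \notin s -> p.2 i = 0.
Proof.
rewrite inE => /predU1P[-> /= ni|]; last exact: nodes_support.
by rewrite /flat (negbTE ni) mul0r.
Qed.

Lemma block_nodes_orthonormal J s : uniq s -> (0 < size s)%N ->
  orthonormal (block_nodes R J s).
Proof.
move=> us s0; rewrite /block_nodes -cat1s orthonormal_cat nodes_orthonormal//=.
have N0 : 0 < (size s)%:R :> R by rewrite ltr0n.
have NN : Num.sqrt (size s)%:R * Num.sqrt (size s)%:R = (size s)%:R :> R.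
  by rewrite -expr2 sqr_sqrtr// ltW.
have flat1 i : i \in s -> flat R s i = (Num.sqrt (size s)%:R)^-1.
  by move=> si; rewrite /flat si mul1r.
apply/andP; split.
  rewrite /orthonormal/= andbT; apply/eqP; rewrite ip_flat// (sum_cst flat1).
  by rewrite mulrAC -invfM NN mulVf// gt_eqF.
rewrite /allrel/= andbT; apply/allP => p ps; apply/eqP; rewrite ipC.
exact: (nodes_cst us ps flat1).
Qed.

Lemma block_family_support bl p i : p \in block_family_nodes bl ->
  i \notin flatten [seq b.2 | b <- bl] -> p.2 i = 0.
Proof.
elim: bl => //= b bl IH; rewrite /block_family_nodes/= [flatten _]/= in_cons.
rewrite -in_cons -cat_cons -/(block_nodes R b.1 b.2) !mem_cat negb_or.
move=> /orP[pb|pl] /andP[ib il]; last exact: IH.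
exact: (block_nodes_support pb).
Qed.

Lemma block_family_orthonormal bl :
  block_family bl -> orthonormal (block_family_nodes bl).
Proof.
elim: bl => //= b bl IH /andP[]; rewrite cat_uniq => /and3P[ub dis ul] /andP[b0 al].
rewrite /block_family_nodes/= -cat_cons -/(block_nodes R b.1 b.2) orthonormal_cat.
rewrite block_nodes_orthonormal// IH /block_family ?ul//=.
apply/allrelP => p q pb ql; apply/eqP; apply: (disjoint_ip dis) => i.
  exact: (block_nodes_support pb).
exact: (block_family_support ql).
Qed.

Lemma block_family_mass bl :
  log_mass (block_family_nodes bl) <= \sum_(b <- bl) 36 * 2 ^+ b.1.
Proof.
elim: bl => [|b bl IH]; first by rewrite /log_mass !big_nil.
rewrite /block_family_nodes/= -cat_cons -/(block_nodes R b.1 b.2).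
rewrite /log_mass big_cat big_cons/= -/(log_mass _) -/(log_mass _) lerD//.
exact: block_mass.
Qed.

Lemma block_family_mgf d (T : measurableType d) (P : probability T R)
    (z : T -> 'I_n -> R) bl : white_noise P z -> block_family bl ->
  (\int[P]_w majorant_prod (block_family_nodes bl) (z w) <=
   (expR (\sum_(b <- bl) 36 * 2 ^+ b.1))%:E)%E.
Proof.
move=> Pz bbl; have ip0 f : ip f (fun=> 0) = 0.
  by apply: big1 => i _; rewrite mulr0.
have := majorant_prod_mgf Pz (block_family_orthonormal bbl)
  (v := fun=> 0) _; rewrite ip0 mul0r add0r => h.
apply: (@le_trans _ _ (expR (log_mass (block_family_nodes bl)))%:E); last first.
  by rewrite lee_fin ler_expR block_family_mass.
apply: le_trans (h _); last by apply/allP => p _; rewrite ip0.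
by under [leRHS]eq_integral do rewrite ipC ip0 expR0 mul1e.
Qed.

Lemma energy_le_majorant (l : seq (nat * ('I_n -> R))) z :
  ((expR (energy l z / 8))%:E <= majorant_prod l z)%E.
Proof.
elim: l => [|p l IH].
  by rewrite /energy /majorant_prod !big_nil mul0r expR0.
rewrite /energy /majorant_prod !big_cons mulrDl expRD EFinM.
apply: lee_pmul; rewrite ?lee_fin ?expR_ge0//; exact: excess_le_majorant.
Qed.

(** Split [|x| <= t + excess t x] and complete the square in the second part. *)
Lemma excess_bound t (x y sigma : R) : 0 < sigma ->
  2 * sigma * (x * y) <= y ^+ 2 / 8 + 8 * sigma ^+ 2 * excess t x ^+ 2
    + 2 * sigma * (t%:R * `|y|).
Proof.
move=> s0; have e0 : 0 <= excess t x by rewrite /excess le_max lexx orbT.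
have xe : `|x| <= t%:R + excess t x.
  by rewrite -lerBlDl /excess le_max lexx.
have xy : x * y <= `|x| * `|y| by rewrite -normrM ler_norm.
have : `|x| * `|y| <= (t%:R + excess t x) * `|y| by rewrite ler_wpM2r.
rewrite -[y ^+ 2]real_normK ?num_real// => h.
have : 0 <= (`|y| - 8 * sigma * excess t x) ^+ 2 by rewrite sqr_ge0.
have : 2 * sigma * (x * y) <= 2 * sigma * ((t%:R + excess t x) * `|y|).
  by rewrite ler_pM2l ?mulr_gt0// (le_trans xy).
lra.
Qed.

Lemma block_bound J s g z (sigma : R) : uniq s -> (0 < size s)%N -> 0 < sigma ->
  2 * sigma * (\sum_(i <- s) z i * g i) <=
  (\sum_(i <- s) g i ^+ 2) / 8 + 8 * sigma ^+ 2 * energy (block_nodes R J s) z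
  + 48 * sigma * (Num.sqrt ((size s).-1%:R / 2 ^+ J) * tv (map g s)).
Proof.
move=> us s0 sg; rewrite -(block_parseval J z g us s0).
under [X in _ <= X / 8 + _ + _]eq_bigr do rewrite expr2.
rewrite -(block_parseval J g g us s0) /energy.
have cost : threshold_cost (block_nodes R J s) g <=
    24 * (Num.sqrt ((size s).-1%:R / 2 ^+ J) * tv (map g s)).
  rewrite /threshold_cost big_cons/= mul0r add0r.
  exact: coarse_cost.
apply: (@le_trans _ _ (\sum_(p <- block_nodes R J s)
    ((ip p.2 g) ^+ 2 / 8 + 8 * sigma ^+ 2 * excess p.1 (ip p.2 z) ^+ 2
     + 2 * sigma * (p.1%:R * `|ip p.2 g|)))).
  by rewrite mulr_sumr; apply: ler_sum => p _; exact: excess_bound.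
rewrite !big_split/= -!mulr_sumr -mulr_suml.
rewrite lerD//.
rewrite -/(threshold_cost _ _) (_ : 48 * sigma * _ = 2 * sigma *
   (24 * (Num.sqrt ((size s).-1%:R / 2 ^+ J) * tv (map g s)))); last by ring.
by rewrite ler_pM2l// mulr_gt0.
Qed.

(** The deterministic half of the argument: on each block the noise is paid by an
    eighth of the energy of [g], by the squared excesses of the noise, and by the
    cost of the thresholds. *)
Lemma block_family_bound bl g z (sigma : R) : block_family bl -> 0 < sigma ->
  2 * sigma * (\sum_(b <- bl) \sum_(i <- b.2) z i * g i) <=
  (\sum_(b <- bl) \sum_(i <- b.2) g i ^+ 2) / 8
  + 8 * sigma ^+ 2 * energy (block_family_nodes bl) z
  + \sum_(b <- bl) 48 * sigma *
      (Num.sqrt ((size b.2).-1%:R / 2 ^+ b.1) * tv (map g b.2)).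
Proof.
move=> + sg; elim: bl => [_|b bl IH].
  by rewrite /energy !big_nil mulr0 mul0r mulr0 !addr0.
rewrite /block_family/= cat_uniq => /andP[/and3P[ub _ ul] /andP[b0 al]].
have {}IH := IH _; rewrite /block_family ul al in IH; have {}IH := IH isT.
have h := block_bound b.1 g z ub b0 sg.
rewrite !big_cons /block_family_nodes/= -cat_cons -/(block_nodes R b.1 b.2).
rewrite /energy big_cat/= -/(energy _ _) -/(energy _ _) -/(block_family_nodes bl).
lra.
Qed.

End block_structures.

(** * Union bound over labelled sets of break points *)

Section entropy.
Context (R : realType).

(** Up to [sigma^2], the part of the penalty that pays for the choice of [m]
    blocks. *)
Definition entropy (n m : nat) : R := m%:R * ln (expR 1 * n%:R / m%:R).

Lemma entropy_ge n m : (m <= n)%N -> m%:R <= entropy n m.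
Proof.
move=> mn; case: m mn => [|m] mn; first by rewrite /entropy mul0r.
have m0 : 0 < m.+1%:R :> R by rewrite ltr0n.
rewrite /entropy ler_peMr// -[leLHS](expRK 1) ler_ln ?posrE ?expR_gt0//.
  by rewrite ler_pdivlMr// ler_pM2l ?expR_gt0// ler_nat.
by rewrite divr_gt0// mulr_gt0 ?expR_gt0// ltr0n (leq_trans _ mn).
Qed.

Lemma expR_entropy n m : (0 < n)%N -> (0 < m)%N ->
  expR (entropy n m) = expR m%:R * (n%:R / m%:R) ^+ m.
Proof.
move=> n0 m0; have [n0' m0'] : 0 < n%:R :> R /\ 0 < m%:R :> R by rewrite !ltr0n.
rewrite /entropy expRM_natl lnK; last by rewrite posrE divr_gt0// mulr_gt0 ?expR_gt0.
by rewrite -mulrA exprMn -expRM_natl mulr1.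
Qed.
End entropy.

Section labels.
Context (R : realType) (n : nat).
Hypothesis n0 : (0 < n)%N.

(** A set of break points, namely the indices with a label, each carrying the
    level of the Haar tree of the block that starts there. *)
Definition label := {ffun 'I_n -> option 'I_n.+1}.
Implicit Types (lab : label) (p q i : 'I_n).

Definition level lab p : nat := if lab p is Some J then J else 0%N.

Definition label_block lab p : {set 'I_n} :=
  [set i : 'I_n | (p <= i)%N && [forall q : 'I_n, (p < q <= i)%N ==> ~~ lab q]]%SET.

Definition starts lab : {set 'I_n} := [set p | lab p]%SET.

Definition label_family lab : seq (nat * seq 'I_n) :=
  [seq (level lab p, enum (label_block lab p)) | p <- enum (starts lab)].

Definition label_cost lab : R := \sum_(p in starts lab) 2 ^+ level lab p.

Lemma label_block_disjoint lab p q i : lab p -> lab q ->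
  i \in label_block lab p -> i \in label_block lab q -> p = q.
Proof.
move=> lp lq; rewrite !inE => /andP[pi /forallP hp] /andP[qi /forallP hq].
case: (ltngtP p q) => [lt|lt|/val_inj//].
  by have := hp q; rewrite lt qi lq.
by have := hq p; rewrite lt pi lp.
Qed.

Lemma uniq_flatten_blocks (I T : eqType) (xs : seq I) (B : I -> seq T) :
  uniq xs -> (forall x, uniq (B x)) ->
  {in xs &, forall x y t, t \in B x -> t \in B y -> x = y} ->
  uniq (flatten [seq B x | x <- xs]).
Proof.
move=> + uB; elim: xs => //= x xs IH /andP[xxs uxs] dis.
rewrite cat_uniq uB IH// ?andbT; last first.
  by move=> a b axs bxs; apply: dis; rewrite inE ?axs ?bxs orbT.
apply/hasPn => t /flatten_mapP[y yxs ty]; apply/negP => tx.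
by move/negP: xxs; apply; rewrite (dis x y _ _ t)// inE ?eqxx// yxs orbT.
Qed.

Lemma label_family_valid lab : block_family (label_family lab).
Proof.
rewrite /block_family /label_family -map_comp; apply/andP; split.
  apply: uniq_flatten_blocks; first exact: enum_uniq.
    by move=> p; exact: enum_uniq.
  move=> p q; rewrite !mem_enum !inE => lp lq i /=; rewrite !mem_enum.
  exact: label_block_disjoint.
rewrite all_map; apply/allP => p _ /=; rewrite -cardE card_gt0; apply/set0Pn.
exists p; rewrite inE leqnn; apply/forallP => q; apply/implyP.
by move=> /andP[/leq_trans h /h]; rewrite ltnn.
Qed.

Lemma label_family_cost lab :
  \sum_(b <- label_family lab) 36 * 2 ^+ b.1 = 36 * label_cost lab.
Proof.
by rewrite /label_family big_map big_enum/= mulr_sumr.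
Qed.

Lemma sum_level_le1 : \sum_(J < n.+1) expR (- 2 ^+ J) <= 1 :> R.
Proof.
apply: (@le_trans _ _ (\sum_(J < n.+1) (2 ^+ J.+1)^-1)).
  apply: ler_sum => J _; rewrite expRN lef_pV2 ?posrE ?expR_gt0 ?exprn_gt0//.
  apply: (@le_trans _ _ (2 ^+ (2 ^ J))).
    by rewrite ler_eXn2l ?ltr1n// ltn_expl.
  rewrite -(natrX _ 2 J) -[X in expR X]mulr1 expRM_natl; apply: lerXn2r.
  - by rewrite nnegrE.
  - by rewrite nnegrE expR_ge0.
  - by have := expR_ge1Dx (1 : R); lra.
suff -> : \sum_(J < n.+1) (2 ^+ J.+1)^-1 = 1 - (2 ^+ n.+1)^-1 :> R.
  by rewrite gerBl invr_ge0 exprn_ge0.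
elim: {+}n => [|k IH]; first by rewrite big_ord1 expr1; lra.
rewrite big_ord_recr/= IH [in RHS]exprS invfM; lra.
Qed.

(** The sum over all labels of [x^(number of starts) exp(-cost)] factorizes over
    the indices and is at most [(1 + x)^n <= exp(n x)]; take [x = m/n]. *)
Lemma label_count (m : nat) : (m <= n)%N ->
  \sum_(lab : label | #|starts lab| == m) expR (- label_cost lab)
  <= expR (entropy R n m).
Proof.
have n0' : 0 < n%:R :> R by rewrite ltr0n.
move=> mn; set x : R := m%:R / n%:R.
have x0 : 0 <= x by rewrite divr_ge0// ltW.
(* The weight x counts the starts and the exponential records their levels. *)
pose F (o : option 'I_n.+1) : R := if o is Some J then x * expR (- 2 ^+ J) else 1.
have FE lab : \prod_p F (lab p) = x ^+ #|starts lab| * expR (- label_cost lab).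
  rewrite /label_cost -sumrN expR_sum -prodr_const -big_split/= [RHS]big_mkcond/=.
  apply: eq_bigr => p _; rewrite inE /F /level.
  by case: (lab p).
have Fsum : \sum_o F o <= 1 + x.
  rewrite (bigD1 None)//= lerD2l.
  rewrite (reindex_onto Some (odflt ord0)) /=; last by case.
  under eq_bigl do rewrite eqxx.
  by rewrite -mulr_sumr ler_piMr// sum_level_le1.
have F0 o : 0 <= F o by case: o => //= J; rewrite mulr_ge0// expR_ge0.
have total : x ^+ m * \sum_(lab : label | #|starts lab| == m) expR (- label_cost lab)
    <= expR m%:R.
  apply: (@le_trans _ _ (\sum_(lab : label) \prod_p F (lab p))).
    rewrite mulr_sumr [leRHS](bigID (fun lab : label => #|starts lab| == m))/=.
    rewrite -[leLHS]addr0 lerD//.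
      by apply: ler_sum => lab /eqP <-; rewrite FE.
    by apply: sumr_ge0 => lab _; apply: prodr_ge0.
  rewrite -(bigA_distr_bigA (fun _ => F)) prodr_const card_ord.
  apply: (@le_trans _ _ ((expR x) ^+ n)).
    apply: lerXn2r; rewrite ?nnegrE ?expR_ge0 ?sumr_ge0//.
    by apply: le_trans Fsum _; exact: expR_ge1Dx.
  by rewrite -expRM_natl /x mulrC divfK// gt_eqF.
case: m => [|m] in mn x x0 F FE Fsum F0 total *.
  by move: total; rewrite expr0 mul1r /entropy !mul0r.
rewrite expR_entropy//.
have m0' : 0 < m.+1%:R :> R by rewrite ltr0n.
rewrite -[n%:R / _]invf_div exprVn -/x ler_pdivlMr ?exprn_gt0 ?divr_gt0//.
by rewrite mulrC.
Qed.

Lemma label_total :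
  \sum_(lab : label) expR (- label_cost lab - 2 * entropy R n #|starts lab|)
  <= 2.
Proof.
have card_lt lab : (#|starts lab| < n.+1)%N.
  by rewrite ltnS -[leqRHS](card_ord n) max_card.
rewrite (partition_big (fun lab : label => Ordinal (card_lt lab)) xpredT)//=.
apply: (@le_trans _ _ (\sum_(m < n.+1) expR (- m%:R))).
  apply: ler_sum => m _.
  have mn : (m <= n)%N by rewrite -ltnS.
  apply: (@le_trans _ _ (expR (entropy R n m) * expR (- (2 * entropy R n m)))).
    apply: le_trans (ler_wpM2r _ (label_count mn)); last exact: expR_ge0.
    rewrite mulr_suml le_eqVlt; apply/orP; left; apply/eqP.
    apply: eq_big => lab; first by rewrite -val_eqE.
    by move=> /eqP <-; rewrite -expRD.
  by rewrite -expRD ler_expR; have := entropy_ge R mn; lra.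
apply: (@le_trans _ _ (\sum_(m < n.+1) (2 ^+ m)^-1)).
  apply: ler_sum => m _; rewrite expRN lef_pV2 ?posrE ?expR_gt0 ?exprn_gt0//.
  rewrite -[X in expR X]mulr1 expRM_natl; apply: lerXn2r.
  - by rewrite nnegrE.
  - by rewrite nnegrE expR_ge0.
  - by have := expR_ge1Dx (1 : R); lra.
suff -> : \sum_(m < n.+1) (2 ^+ m)^-1 = 2 - (2 ^+ n)^-1 :> R.
  by rewrite gerBl invr_ge0 exprn_ge0.
elim: {+}n => [|k IH]; first by rewrite big_ord1 expr0; lra.
rewrite big_ord_recr/= IH [in RHS]exprS [in LHS]exprS invfM; lra.
Qed.

(** The random variable [Y]: a weighted sum over all labels of the majorants of
    the corresponding block families.  In the weights, [36] out of [37] pays for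
    [block_family_mgf] and the rest makes the sum over the levels converge; one
    of the two entropies pays for [label_count] and the other one makes the sum
    over the number of starts converge. *)
Definition union_majorant (z : 'I_n -> R) : \bar R :=
  (\sum_(lab : label)
    (expR (- (37 * label_cost lab) - 2 * entropy R n #|starts lab|))%:E *
    majorant_prod (block_family_nodes R (label_family lab)) z)%E.

Lemma union_majorant_ge0 z : (0 <= union_majorant z)%E.
Proof.
by apply: sume_ge0 => lab _; rewrite mule_ge0 ?majorant_prod_ge0// lee_fin expR_ge0.
Qed.

Lemma measurable_union_majorant d (T : measurableType d) (z : T -> 'I_n -> R) :
  (forall i, measurable_fun setT (z ^~ i)) ->
  measurable_fun setT (fun w => union_majorant (z w)).
Proof.
move=> mz; apply: emeasurable_sum => lab.
by apply: measurable_funeM; exact: measurable_majorant_prod.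
Qed.

Lemma union_majorant_mean d (T : measurableType d) (P : probability T R)
    (z : T -> 'I_n -> R) : white_noise P z ->
  (\int[P]_w union_majorant (z w) <= 2%:E)%E.
Proof.
move=> Pz; have [mz _] := Pz.
rewrite /union_majorant ge0_integral_sum//; last 2 first.
- by move=> lab; apply: measurable_funeM; exact: measurable_majorant_prod.
- by move=> lab w _; rewrite mule_ge0 ?majorant_prod_ge0// lee_fin expR_ge0.
apply: (@le_trans _ _ (\sum_(lab : label)
   (expR (- label_cost lab - 2 * entropy R n #|starts lab|))%:E)%E); last first.
  by rewrite sumEFin lee_fin label_total.
apply: lee_sum => lab _.
rewrite ge0_integralZl//; last 2 first.
- exact: measurable_majorant_prod.
- by move=> w _; exact: majorant_prod_ge0.
apply: le_trans.
  apply: lee_wpmul2l; first by rewrite lee_fin expR_ge0.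
  exact: (block_family_mgf Pz (label_family_valid lab)).
rewrite label_family_cost -EFinM lee_fin -expRD ler_expR; lra.
Qed.

(** From [a <= b + exp(a - b)], the exponential being one of the terms of
    [union_majorant]. *)
Lemma energy_le_union lab z :
  ((energy (block_family_nodes R (label_family lab)) z)%:E <=
   (8 * (37 * label_cost lab + 2 * entropy R n #|starts lab|))%:E
   + 8%:E * union_majorant z)%E.
Proof.
set E := energy _ z; set K := 37 * _ + _.
apply: (@le_trans _ _ ((8 * K)%:E + 8%:E * (expR (E / 8 - K))%:E)%E).
  by rewrite -EFinM -EFinD lee_fin; have := expR_ge1Dx (E / 8 - K); lra.
rewrite leeD2l// lee_wpmul2l ?lee_fin//.
rewrite /union_majorant (bigD1 lab)//= -[leLHS]adde0; apply: leeD; last first.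
  by apply: sume_ge0 => lab' _; rewrite mule_ge0 ?majorant_prod_ge0// lee_fin expR_ge0.
rewrite addrC expRD EFinM /K opprD; apply: lee_wpmul2l; first by rewrite lee_fin expR_ge0.
exact: energy_le_majorant.
Qed.

End labels.

(** * Connected partitions and their common refinement *)

Section entropy_subadditive.
Context (R : realType).

(** With [t = m'/m], [ln t <= t - 1] and [ln(en/m') >= 1]. *)
Lemma entropy_mono (n m m' : nat) : (m <= m')%N -> (m' <= n)%N ->
  entropy R n m <= entropy R n m'.
Proof.
case: m => [|m] mm' m'n.
  by rewrite {1}/entropy mul0r (le_trans _ (entropy_ge R m'n)).
have m0 : 0 < m.+1%:R :> R by rewrite ltr0n.
have m'0 : 0 < m'%:R :> R by rewrite ltr0n (leq_trans _ mm').
have n0 : 0 < n%:R :> R by rewrite ltr0n (leq_trans _ m'n)// (leq_trans _ mm').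
have en : 0 < expR 1 * n%:R :> R by rewrite mulr_gt0 ?expR_gt0.
have h1 : 1 <= ln (expR 1 * n%:R / m'%:R) :> R.
  have := entropy_ge R m'n; rewrite /entropy; set l := ln _ => h.
  by rewrite -(ler_pM2l m'0) mulr1.
have h2 : ln (expR 1 * n%:R / m.+1%:R) =
    ln (expR 1 * n%:R / m'%:R) + ln (m'%:R / m.+1%:R) :> R.
  rewrite -lnM ?posrE ?divr_gt0//; congr ln; field.
  by rewrite !gt_eqF.
have h3 : ln (m'%:R / m.+1%:R) <= m'%:R / m.+1%:R - 1 :> R.
  have := @le_ln1Dx R (m'%:R / m.+1%:R - 1); rewrite subrKC; apply.
  by rewrite ltrBrDr addNr divr_gt0.
have h4 : m.+1%:R * ln (m'%:R / m.+1%:R) <= m'%:R - m.+1%:R :> R.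
  rewrite (_ : _ - _ = m.+1%:R * (m'%:R / m.+1%:R - 1) :> R).
    by rewrite ler_pM2l.
  by field; rewrite gt_eqF.
have h5 : m.+1%:R <= m'%:R :> R by rewrite ler_nat.
rewrite /entropy h2; nra.
Qed.

Lemma entropy_subadd (n m m' k : nat) : (m <= n)%N -> (m' <= n)%N -> (k <= n)%N ->
  (k <= m + m')%N -> entropy R n k <= entropy R n m + entropy R n m'.
Proof.
move=> mn m'n kn kmm.
have [km|mk] := leqP k m.
  have := entropy_mono km mn; have := entropy_ge R m'n.
  have : 0 <= m'%:R :> R by []. lra.
pose b := (k - m)%N; have bm : (b <= m')%N by rewrite /b; lia.
have := entropy_mono bm m'n.
suff : entropy R n k <= entropy R n m + entropy R n b by lra.
have -> : k = (m + b)%N by rewrite /b; lia.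
have b0 : (0 < b)%N by rewrite /b; lia.
have bn : (m + b <= n)%N by rewrite /b; lia.
have n0 : (0 < n)%N by lia.
have sub a c : (a <= c)%N -> (0 < c)%N -> a%:R * ln (expR 1 * n%:R / c%:R) <= entropy R n a.
  case: a => [|a] ac c0; first by rewrite /entropy !mul0r.
  rewrite /entropy ler_pM2l ?ltr0n// ler_ln ?posrE ?divr_gt0 ?mulr_gt0 ?expR_gt0 ?ltr0n//.
  rewrite ler_pM2l ?mulr_gt0 ?expR_gt0 ?ltr0n//.
  by rewrite lef_pV2 ?posrE ?ltr0n// ler_nat.
have -> : entropy R n (m + b) =
    (m%:R + b%:R) * ln (expR 1 * n%:R / (m + b)%:R) by rewrite -natrD.
by rewrite mulrDl lerD// sub//; lia.
Qed.
End entropy_subadditive.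

Section partitions.
Context (n m : nat) (A : 'I_m -> {set 'I_n}).
Hypothesis cpA : connected_partition A.

Definition heads : {set 'I_n} :=
  [set p | [exists k, (p \in A k) && [forall q in A k, (p <= q)%N]]]%SET.

Lemma partition_index : exists idx : 'I_n -> 'I_m,
  forall i k, (i \in A k) = (k == idx i).
Proof.
have [idx Hidx] := choice (cp_cover cpA).
exists idx => i k; apply/idP/eqP => [ik|->//].
apply/eqP/negPn/negP => kk; have /setP/(_ i) := cp_disjoint cpA kk.
by rewrite !inE ik Hidx.
Qed.

Lemma block_head k i : i \in A k ->
  exists q, [/\ q \in heads, q \in A k & (q <= i)%N].
Proof.
move=> ik; have [q qk qmin] := @arg_minnP _ i (fun j => j \in A k) val ik.
exists q; split=> //; last exact: qmin.
rewrite inE; apply/existsP; exists k; rewrite qk/=.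
by apply/forall_inP => j /qmin.
Qed.

Lemma card_heads : (#|heads| <= m)%N.
Proof.
have [idx Hidx] := partition_index.
rewrite -[leqRHS](card_ord m) -(@card_in_imset _ _ idx heads) ?max_card//.
move=> p q; rewrite !inE => /existsP[k /andP[pk /forall_inP hp]].
move=> /existsP[l /andP[ql /forall_inP hq]] pq; apply/val_inj/eqP.
have kl : k = l.
  by move: pk ql; rewrite !Hidx => /eqP -> /eqP ->.
by rewrite eqn_leq hp ?hq// -?kl// kl.
Qed.

Lemma partition_size : (m <= n)%N.
Proof.
have [idx Hidx] := partition_index.
rewrite -[leqLHS](card_ord m) -[leqRHS](card_ord n).
rewrite -cardsT -(_ : idx @: [set: 'I_n] = [set: 'I_m])%SET.
  by rewrite (leq_trans (leq_imset_card _ _))// cardsT.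
apply/setP => k; rewrite inE; apply/imsetP.
have /set0Pn[i] := cp_nonempty cpA k; rewrite Hidx => /eqP ->.
by exists i; rewrite ?inE.
Qed.

Lemma partition_pos : (0 < n)%N -> (0 < m)%N.
Proof.
by move=> n0; have [[k km] _] := cp_cover cpA (Ordinal n0); exact: leq_trans km.
Qed.

End partitions.

Section last_start.
Context (n : nat) (S : {set 'I_n}).
Hypothesis S_first : forall i : 'I_n, exists2 p, p \in S & (p <= i)%N.

(** The map sending an index to the start of its block in the refinement. *)
Lemma last_start : exists c : 'I_n -> 'I_n, forall i,
  [/\ c i \in S, (c i <= i)%N & forall q, q \in S -> (q <= i)%N -> (q <= c i)%N].
Proof.
suff : forall i : 'I_n, exists p : 'I_n, [/\ p \in S, (p <= i)%N &
    forall q, q \in S -> (q <= i)%N -> (q <= p)%N].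
  by move=> /choice[c Hc]; exists c.
move=> i; have [p0 p0S p0i] := S_first i.
have P0 : (p0 \in S) && (p0 <= i)%N by rewrite p0S.
have [p /andP[pS pi] pmax] := @arg_maxnP _ p0 (fun p => (p \in S) && (p <= i)%N) val P0.
exists p; split => // q qS qi; apply: pmax; by rewrite qS.
Qed.
End last_start.

(** Cutting a vector into consecutive pieces can only lose the jumps between
    pieces.  The pieces are the level sets of a map [c] that is nondecreasing
    along [s]. *)
Lemma sum_tv_pieces (R : realType) (n : nat) (I : eqType) (f : I -> R)
    (c : I -> 'I_n) (s : seq I) :
  pairwise (fun x y => (c x <= c y)%N) s ->
  \sum_(p < n) tv (map f [seq x <- s | c x == p]) <= tv (map f s).
Proof.
elim: s => [_|x s IH] /=.
  by rewrite tv_nil big1// => p _; rewrite tv_nil.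
move=> /andP[xs pws]; have {}IH := IH pws.
rewrite (bigD1 (c x))//= eqxx/=.
have others : \sum_(p < n | p != c x)
      tv [seq f i | i <- if c x == p then x :: [seq i <- s | c i == p]
                         else [seq i <- s | c i == p]] =
    \sum_(p < n | p != c x) tv [seq f i | i <- s & c i == p].
  by apply: eq_bigr => p; rewrite eq_sym => /negbTE ->.
rewrite others.
move: IH; rewrite (bigD1 (c x))//=.
case: s xs pws {others} => [_ _|y s /= /andP[xy ys] pws].
  by rewrite /= tv_nil tv1.
have [cyx|cyx] := eqVneq (c y) (c x).
  by rewrite /= !tv_cons => h; rewrite -addrA lerD2l.
have cxy : (c x < c y)%N by rewrite ltn_neqAle xy andbT eq_sym.
rewrite (_ : [seq i <- s | c i == c x] = [::]) /= ?tv1 ?tv_nil.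
  by rewrite !add0r tv_cons => h; rewrite (le_trans h)// lerDr.
apply/eqP; rewrite -[_ == _]negbK -has_filter; apply/hasPn => i si.
have /allP/(_ i si) /= cyi : all (fun z => (c y <= c z)%N) s.
  by move: pws => /andP[].
by rewrite -val_eqE gtn_eqF// (leq_trans cxy).
Qed.

(** * Choice of the resolution *)

Section rates.
Context (R : realType).
Implicit Types (x : R).

Definition cbrt x : R := x `^ (1 / 3).

Lemma cbrt_gt0 x : 0 < x -> 0 < cbrt x.
Proof. exact: powR_gt0. Qed.

Lemma cbrtX x (k : nat) : 0 < x -> cbrt x ^+ k = x `^ (k%:R / 3).
Proof.
move=> x0; rewrite -powR_mulrn ?powR_ge0// /cbrt -powRrM.
by congr (_ `^ _); rewrite mulrC mul1r.
Qed.

Lemma cbrtK x : 0 < x -> cbrt x ^+ 3 = x.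
Proof. by move=> x0; rewrite cbrtX// divff// powRr1// ltW. Qed.

(** This is [(v / (sigma a))^(2/3)]: the number of cells per unit length in the
    approximation of a function of variation [v] on a block of length [a]. *)
Definition resolution (sigma a v : R) : R :=
  (cbrt v / (cbrt sigma * cbrt a)) ^+ 2.

Definition block_rate (sigma a v : R) : R :=
  sigma `^ (4 / 3) * a `^ (1 / 3) * v `^ (2 / 3).

Lemma resolution_gt0 sigma a v : 0 < sigma -> 0 < a -> 0 < v ->
  0 < resolution sigma a v.
Proof. by move=> *; rewrite exprn_gt0// divr_gt0 ?mulr_gt0 ?cbrt_gt0. Qed.

Lemma block_rateE sigma a v : 0 < sigma -> 0 < a -> 0 < v ->
  block_rate sigma a v = cbrt sigma ^+ 4 * cbrt a * cbrt v ^+ 2.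
Proof. by move=> s0 a0 v0; rewrite /block_rate !cbrtX. Qed.

(** One unit [sigma^2] per cell costs exactly the rate of the block. *)
Lemma resolution_coarse sigma a v : 0 < sigma -> 0 < a -> 0 < v ->
  sigma ^+ 2 * (a * resolution sigma a v) = block_rate sigma a v.
Proof.
move=> s0 a0 v0; rewrite block_rateE// /resolution.
rewrite -{1}(cbrtK s0) -{1}(cbrtK a0); field.
by rewrite !gt_eqF ?cbrt_gt0.
Qed.

(** [cbrt sigma * cbrt a / cbrt v] is the square root of the cell length; the
    variation inside the cells also costs exactly the rate. *)
Lemma resolution_fine sigma a v : 0 < sigma -> 0 < a -> 0 < v ->
  sigma * (cbrt sigma * cbrt a / cbrt v * v) = block_rate sigma a v.
Proof.
move=> s0 a0 v0; rewrite block_rateE//.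
rewrite -{1}(cbrtK s0) -{2}(cbrtK v0); field.
by rewrite !gt_eqF ?cbrt_gt0.
Qed.

Lemma sqrt_le_resolution sigma a v x y : 0 < sigma -> 0 < a -> 0 < v -> 0 < y ->
  x * resolution sigma a v <= y ->
  Num.sqrt (x / y) <= cbrt sigma * cbrt a / cbrt v.
Proof.
move=> s0 a0 v0 y0 xy.
have r0 : 0 <= cbrt sigma * cbrt a / cbrt v.
  by rewrite divr_ge0 ?mulr_ge0// ltW// cbrt_gt0.
rewrite -[leRHS]ger0_norm// -sqrtr_sqr; apply: ler_wsqrtr.
have -> : (cbrt sigma * cbrt a / cbrt v) ^+ 2 = (resolution sigma a v)^-1.
  by rewrite /resolution -exprVn invf_div.
by rewrite ler_pdivrMr// mulrC ler_pdivlMr ?resolution_gt0// .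
Qed.

Lemma dyadic_level x : 0 <= x -> exists J : nat, x <= 2 ^+ J <= 1 + 2 * x.
Proof.
move=> x0.
have ex : exists J : nat, x <= 2 ^+ J.
  exists (Num.trunc x).+1; have /andP[_ xt] := truncn_itv x0.
  by rewrite (le_trans (ltW xt))// -natrX ler_nat ltnW// ltn_expl.
have [[|J] xJ Jmin] := ex_minnP ex.
  by exists 0%N; rewrite xJ expr0; lra.
exists J.+1; rewrite xJ/=.
have : ~~ (x <= 2 ^+ J) by apply/negP => /Jmin; rewrite ltnn.
rewrite -ltNge exprS; lra.
Qed.

End rates.

Section pieces.
Context (R : realType) (n m : nat) (A : 'I_m -> {set 'I_n}) (idx : 'I_n -> 'I_m).
Hypothesis idxP : forall i k, (i \in A k) = (k == idx i).
Variable (S : {set 'I_n}) (c : 'I_n -> 'I_n).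
Hypothesis cP : forall i, [/\ c i \in S, (c i <= i)%N &
  forall q, q \in S -> (q <= i)%N -> (q <= c i)%N].

(** A block of the refinement lies in a single block of each partition. *)
Lemma last_start_index : connected_partition A -> heads A \subset S ->
  forall i, idx (c i) = idx i.
Proof.
move=> cpA /fintype.subsetP hS i; have [_ ci cmax] := cP i.
have ik : i \in A (idx i) by rewrite idxP.
have [q [qh qk qi]] := block_head ik.
have qc := cmax q (hS _ qh) qi.
by apply/esym/eqP; rewrite -idxP; apply: (cp_interval cpA (j := q) (l := i)) => //; rewrite qc.
Qed.

Lemma last_start_mono (i j : 'I_n) : (i <= j)%N -> (c i <= c j)%N.
Proof.
by move=> ij; have [cS ci _] := cP i; have [_ _ h] := cP j; apply: h => //; exact: leq_trans ij.
Qed.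

Lemma pairwise_last_start (B : {set 'I_n}) :
  pairwise (fun x y => (c x <= c y)%N) (enum B).
Proof.
have : pairwise (fun x y : 'I_n => (x <= y)%N) (enum B).
  rewrite {1}/enum_mem; apply: pairwise_filter.
  rewrite -enumT -(pairwise_map val (fun x y => (x <= y)%N)) val_enum_ord.
  by rewrite -sorted_pairwise ?iota_sorted//; exact: leq_trans.
by apply: sub_pairwise => x y; exact: last_start_mono.
Qed.

(** The variations over the pieces of the refinement are regrouped by block of the
    coarser partition [A]. *)
Lemma sum_tv_index (f : 'I_n -> R) (w : 'I_m -> R) : (forall k, 0 <= w k) ->
  (forall i, idx (c i) = idx i) ->
  \sum_(p in S) w (idx p) * tv (map f (enum [set i | c i == p]%SET)) <=
  \sum_k w k * tv (map f (enum (A k))).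
Proof.
move=> w0 cidx; rewrite (partition_big idx xpredT)//=.
apply: ler_sum => k _.
apply: (@le_trans _ _ (\sum_(p in S | idx p == k)
    w k * tv (map f [seq x <- enum (A k) | c x == p]))).
  rewrite le_eqVlt; apply/orP; left; apply/eqP.
  apply: eq_bigr => p /andP[_ /eqP pk]; rewrite pk; congr (_ * tv (map f _)).
  rewrite /enum_mem -filter_predI; apply: eq_filter => i /=.
  rewrite !inE idxP; case: eqP => //= cp.
  by rewrite -pk -cp cidx eqxx.
rewrite -mulr_sumr ler_wpM2l//.
apply: le_trans (sum_tv_pieces f (pairwise_last_start (A k))).
rewrite [leRHS](bigID (fun p => (p \in S) && (idx p == k)))/= lerDl.
by apply: sumr_ge0 => p _; exact: tv_ge0.
Qed.

End pieces.

Definition complexity (R : realType) (n m : nat) (sigma : R)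
    (A : 'I_m -> {set 'I_n}) (V : 'I_m -> R) : R :=
  \sum_(i < m) block_rate sigma #|A i|%:R (V i) + sigma ^+ 2 * entropy R n m.

Lemma penE (R : realType) (n m : nat) (Cpen sigma : R)
    (A : 'I_m -> {set 'I_n}) (V : 'I_m -> R) :
  pen Cpen sigma A V = Cpen * complexity sigma A V.
Proof. by rewrite /pen /complexity /entropy mulrA. Qed.

(** * The noise term, uniformly over all models *)

Section noise.
Context (R : realType) (n : nat).

Lemma label_block_last (lab : label n) (c : 'I_n -> 'I_n) p :
  (forall i, [/\ c i \in starts lab, (c i <= i)%N &
    forall q, q \in starts lab -> (q <= i)%N -> (q <= c i)%N]) ->
  p \in starts lab -> label_block lab p = [set i | c i == p]%SET.
Proof.
move=> cP pS; apply/setP => i; have [ciS ci cmax] := cP i; rewrite !inE.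
apply/andP/eqP => [[pi /forallP h]|<-].
  apply/val_inj/eqP; rewrite eqn_leq (cmax _ pS pi) andbT leqNgt.
  apply/negP => pc; move: (h (c i)); rewrite pc ci/=.
  by rewrite inE in ciS; rewrite ciS.
split=> //; apply/forallP => q; apply/implyP => /andP[cq qi]; apply/negP => lq.
by have := cmax q; rewrite inE lq qi => /(_ isT isT); rewrite leqNgt cq.
Qed.

Lemma sum_over_blocks (S : {set 'I_n}) (c : 'I_n -> 'I_n) (F : 'I_n -> R) :
  (forall i, c i \in S) ->
  \sum_(p in S) \sum_(i <- enum [set i | c i == p]%SET) F i = \sum_i F i.
Proof.
move=> cS; rewrite [RHS](partition_big c (mem S))//=.
apply: eq_bigr => p pS; rewrite big_enum/=; apply: eq_bigl => i.
by rewrite inE.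
Qed.

Lemma block_nodes_cap (J J' : nat) (s : seq 'I_n) :
  (size s <= J)%N -> (size s <= J')%N -> block_nodes R J s = block_nodes R J' s.
Proof. by move=> sJ sJ'; rewrite /block_nodes (@nodes_cap _ _ _ _ _ 0 s sJ sJ'). Qed.

Section two_partitions.
Context (m m' : nat) (A : 'I_m -> {set 'I_n}) (A' : 'I_m' -> {set 'I_n}).
Context (V : 'I_m -> R) (V' : 'I_m' -> R) (sigma : R).
Hypotheses (cpA : connected_partition A) (cpA' : connected_partition A').
Hypotheses (V0 : forall k, 0 < V k) (V'0 : forall k, 0 < V' k) (s0 : 0 < sigma).

(** On a piece [B p] of the common refinement the resolution is the sum of those
    of the two blocks containing it, and [2^J] is the least power of two above
    the number of cells.  As the resolution depends only on the two blocks, both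
    the number of cells and the threshold costs add up over the pieces to the
    rates of the blocks of [A] and [A'].  The factor in front of the complexities
    comes from [64 * 37 * 2 + 48] for the rates and [64 * (37 + 2)] for the
    entropies. *)
Lemma noise_bound (f u z : 'I_n -> R) :
  (forall k, tv (map f (enum (A k))) <= V k) ->
  (forall k, tv (map u (enum (A' k))) <= V' k) ->
  ((2 * sigma * \sum_i z i * (u i - f i))%:E <=
   ((\sum_i (u i - f i) ^+ 2) / 8
     + (50 * 100) * (complexity sigma A V + complexity sigma A' V'))%:E
   + (64 * sigma ^+ 2)%:E * union_majorant z)%E.
Proof.
move=> fV uV'.
have [idx idxP] := partition_index cpA.
have [idx' idxP'] := partition_index cpA'.
pose S := heads A :|: heads A'.
have hA : heads A \subset S by exact: finset.subsetUl.
have hA' : heads A' \subset S by exact: finset.subsetUr.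
have Sfirst (i : 'I_n) : exists2 p, p \in S & (p <= i)%N.
  have ik : i \in A (idx i) by rewrite idxP.
  by have [q [qh _ qi]] := block_head ik; exists q; rewrite // inE qh.
have [c cP] := last_start Sfirst.
have cS i : c i \in S by have [] := cP i.
have cidx := last_start_index idxP cP cpA hA.
have cidx' := last_start_index idxP' cP cpA' hA'.
have A0 k : 0 < #|A k|%:R :> R.
  by rewrite ltr0n card_gt0; exact: cp_nonempty cpA k.
have A'0 k : 0 < #|A' k|%:R :> R.
  by rewrite ltr0n card_gt0; exact: cp_nonempty cpA' k.
pose rho k := resolution sigma #|A k|%:R (V k).
pose rho' k := resolution sigma #|A' k|%:R (V' k).
have rho0 k : 0 < rho k by exact: resolution_gt0.
have rho'0 k : 0 < rho' k by exact: resolution_gt0.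
pose B p := [set i | c i == p]%SET.
(* the number of cells wanted in the piece that starts at p *)
pose target p : R := #|B p|%:R * (rho (idx p) + rho' (idx' p)).
have target0 p : 0 <= target p by rewrite mulr_ge0// addr_ge0// ltW.
have [J JP] := choice (fun p => dyadic_level (target0 p)).
pose lab : label n := [ffun p => if p \in S then Some (inord (minn (J p) n)) else None].
have labS : starts lab = S.
  by apply/setP => p; rewrite inE ffunE; case: (p \in S).
have level_lab p : p \in S -> level lab p = minn (J p) n.
  by move=> pS; rewrite /level ffunE pS inordK// ltnS geq_minr.
have blockE p : p \in S -> label_block lab p = B p.
  by move=> pS; apply: label_block_last; rewrite labS.
pose bl := [seq (J p, enum (B p)) | p <- enum S].
have blE : [seq b.2 | b <- bl] = [seq b.2 | b <- label_family lab].
  rewrite /label_family labS -!map_comp; apply/eq_in_map => p.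
  by rewrite mem_enum /= => pS; rewrite blockE.
(* Levels above n are truncated to n, which leaves the trees unchanged. *)
have nodesE : block_family_nodes R bl = block_family_nodes R (label_family lab).
  rewrite /block_family_nodes /label_family labS -!map_comp; congr flatten.
  apply/eq_in_map => p; rewrite mem_enum /= => pS; rewrite blockE// level_lab//.
  have [Jn|nJ] := leqP (J p) n; first by [].
  have Bn : (size (enum (B p)) <= n)%N.
    by rewrite -cardE -[leqRHS](card_ord n) max_card.
  by apply: block_nodes_cap => //; exact: leq_trans (ltnW nJ).
have bl_ok : block_family bl.
  have := label_family_valid lab; rewrite /block_family -blE.
  rewrite -!(all_map snd (fun s => 0 < size s)%N); congr (_ && all _ _).
  by rewrite -blE.
pose g i := u i - f i.
have main := block_family_bound g z bl_ok s0.
have sumE F : \sum_(b <- bl) \sum_(i <- b.2) F i = \sum_i F i :> R.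
  by rewrite /bl big_map big_enum/= sum_over_blocks.
rewrite !sumE nodesE in main.
have Mn : (#|S| <= n)%N by rewrite -[leqRHS](card_ord n) max_card.
have Mm : (#|S| <= m + m')%N.
  rewrite (leq_trans (leq_card_setU _ _))// leq_add//; exact: card_heads.
have ent := entropy_subadd R (partition_size cpA) (partition_size cpA') Mn Mm.
have Ment := entropy_ge R Mn.
pose Q := \sum_k block_rate sigma #|A k|%:R (V k).
pose Q' := \sum_k block_rate sigma #|A' k|%:R (V' k).
have coarse : sigma ^+ 2 * label_cost R lab <= sigma ^+ 2 * #|S|%:R + 2 * (Q + Q').
  have sumidx (k0 : nat) (D : 'I_k0 -> {set 'I_n}) (ix : 'I_n -> 'I_k0) (w : 'I_k0 -> R) :
      (forall i k, (i \in D k) = (k == ix i)) ->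
      (forall i, ix (c i) = ix i) ->
      \sum_(p in S) #|B p|%:R * w (ix p) = \sum_k #|D k|%:R * w k.
    move=> ixP cix; transitivity (\sum_i w (ix i)).
      rewrite -(sum_over_blocks _ cS); apply: eq_bigr => p pS.
      rewrite big_enum/= (eq_bigr (fun=> w (ix p))) => [|i].
        by rewrite sumr_const mulr_natl.
      by rewrite inE -cix => /eqP ->.
    rewrite (partition_big ix xpredT)//=; apply: eq_bigr => k _.
    rewrite (eq_bigr (fun=> w k)) => [|i /eqP -> //].
    rewrite sumr_const mulr_natl; congr (_ *+ _); apply: eq_card => i.
    by rewrite ixP eq_sym.
  have step : label_cost R lab <= #|S|%:R + 2 * \sum_(p in S) target p.
    rewrite /label_cost labS mulr_sumr -sumr_const -big_split/=.
    apply: ler_sum => p pS; rewrite level_lab//.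
    have /andP[_ h] := JP p; apply: le_trans h.
    by rewrite ler_weXn2l ?ler1n// geq_minl.
  have targetE : \sum_(p in S) target p =
      \sum_k #|A k|%:R * rho k + \sum_k #|A' k|%:R * rho' k.
    rewrite -(sumidx _ A idx)// -(sumidx _ A' idx')// -big_split/=.
    by apply: eq_bigr => p _; rewrite -mulrDr.
  have QE : Q = sigma ^+ 2 * \sum_k #|A k|%:R * rho k.
    by rewrite mulr_sumr; apply: eq_bigr => k _; rewrite resolution_coarse.
  have Q'E : Q' = sigma ^+ 2 * \sum_k #|A' k|%:R * rho' k.
    by rewrite mulr_sumr; apply: eq_bigr => k _; rewrite resolution_coarse.
  rewrite QE Q'E -mulrDr -targetE mulrCA -mulrDr ler_pM2l//.
  by rewrite exprn_gt0.
pose w k := cbrt sigma * cbrt #|A k|%:R / cbrt (V k).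
pose w' k := cbrt sigma * cbrt #|A' k|%:R / cbrt (V' k).
have w0 k : 0 <= w k by rewrite divr_ge0 ?mulr_ge0// ltW// cbrt_gt0.
have w'0 k : 0 <= w' k by rewrite divr_ge0 ?mulr_ge0// ltW// cbrt_gt0.
have fine : \sum_(b <- bl) 48 * sigma *
    (Num.sqrt ((size b.2).-1%:R / 2 ^+ b.1) * tv (map g b.2)) <= 48 * (Q + Q').
  rewrite /bl big_map big_enum/=.
  apply: (@le_trans _ _ (48 * sigma * (\sum_(p in S) w (idx p) * tv (map f (enum (B p)))
      + \sum_(p in S) w' (idx' p) * tv (map u (enum (B p)))))).
    rewrite -big_split/= mulr_sumr; apply: ler_sum => p pS.
    rewrite ler_pM2l ?mulr_gt0//.
    set q := Num.sqrt _.
    have q0 : 0 <= q by exact: sqrtr_ge0.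
    have J0 : 0 < 2 ^+ J p :> R by rewrite exprn_gt0.
    have /andP[hJ _] := JP p.
    have NB : (size (enum (B p))).-1%:R <= #|B p|%:R :> R.
      by rewrite -cardE ler_nat leq_pred.
    have qw : q <= w (idx p).
      apply: sqrt_le_resolution => //; apply: le_trans hJ.
      rewrite -/(rho (idx p)); have := rho0 (idx p); have := rho'0 (idx' p).
      by move=> h1 h2; apply: ler_pM => //; rewrite ?lerDl ltW.
    have qw' : q <= w' (idx' p).
      apply: sqrt_le_resolution => //; apply: le_trans hJ.
      rewrite -/(rho' (idx' p)); have := rho0 (idx p); have := rho'0 (idx' p).
      by move=> h1 h2; apply: ler_pM => //; rewrite ?lerDr ltW.
    apply: (@le_trans _ _ (q * (tv (map u (enum (B p))) + tv (map f (enum (B p)))))).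
      by rewrite ler_wpM2l// tv_map_sub.
    by rewrite addrC mulrDr lerD// ler_wpM2r// tv_ge0.
  rewrite -mulrA ler_pM2l// mulrDr lerD//.
    apply: (@le_trans _ _ (sigma * \sum_k w k * tv (map f (enum (A k))))).
      by rewrite ler_pM2l// sum_tv_index.
    rewrite mulr_sumr; apply: ler_sum => k _.
    by rewrite -(resolution_fine s0 (A0 k) (V0 k)) ler_pM2l// ler_wpM2l.
  apply: (@le_trans _ _ (sigma * \sum_k w' k * tv (map u (enum (A' k))))).
    by rewrite ler_pM2l// sum_tv_index.
  rewrite mulr_sumr; apply: ler_sum => k _.
  by rewrite -(resolution_fine s0 (A'0 k) (V'0 k)) ler_pM2l// ler_wpM2l.
have Q0 : 0 <= Q by apply: sumr_ge0 => k _; rewrite !mulr_ge0 ?powR_ge0.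
have Q'0 : 0 <= Q' by apply: sumr_ge0 => k _; rewrite !mulr_ge0 ?powR_ge0.
have en := energy_le_union lab z; rewrite labS in en.
set E := energy _ _ in main en.
apply: (@le_trans _ _ (((\sum_i g i ^+ 2) / 8 + 48 * (Q + Q'))%:E
    + (8 * sigma ^+ 2)%:E * E%:E)%E).
  rewrite -EFinM -EFinD lee_fin; lra.
have s2 : 0 <= sigma ^+ 2 by exact: sqr_ge0.
apply: le_trans.
  apply: leeD2l; apply: (lee_wpmul2l _ en); rewrite lee_fin; lra.
rewrite ge0_muleDr ?lee_fin ?mule_ge0 ?union_majorant_ge0//; last first.
  have c0 : 0 <= label_cost R lab by apply: sumr_ge0 => p _; exact: exprn_ge0.
  have e0 : 0 <= entropy R n #|S| by exact: le_trans Ment.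
  lra.
rewrite addeA muleA -!EFinM -EFinD.
apply: leeD; last by rewrite (_ : 8 * sigma ^+ 2 * 8 = 64 * sigma ^+ 2)//; ring.
rewrite lee_fin /complexity -/Q -/Q'.
set ph := entropy R n m in ent *; set ph' := entropy R n m' in ent *.
have e1 : sigma ^+ 2 * entropy R n #|S| <= sigma ^+ 2 * (ph + ph').
  by rewrite ler_wpM2l.
have e2 : sigma ^+ 2 * #|S|%:R <= sigma ^+ 2 * (ph + ph').
  by rewrite ler_wpM2l// (le_trans Ment).
have e3 : 0 <= sigma ^+ 2 * (ph + ph').
  by apply: le_trans e2; rewrite mulr_ge0.
lra.
Qed.

End two_partitions.
End noise.

(** * Euclidean projections *)

Section projection.
Context (R : realType) (n : nat).
Implicit Types (u x y : 'rV[R]_n).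

Lemma enorm_sqr u : enorm u ^+ 2 = \sum_(i < n) u 0 i ^+ 2.
Proof. by rewrite sqr_sqrtr// sumr_ge0// => i _; exact: sqr_ge0. Qed.

Lemma enorm_ge0 u : 0 <= enorm u.
Proof. exact: sqrtr_ge0. Qed.

Lemma enorm_le_sqr u y : (enorm u <= enorm y) = (enorm u ^+ 2 <= enorm y ^+ 2).
Proof. by rewrite ler_pXn2r// nnegrE enorm_ge0. Qed.

Lemma continuous_enorm_sqr x : continuous (fun u => enorm (x - u) ^+ 2).
Proof.
rewrite (_ : (fun u => _) = fun u => \sum_(i < n) (x 0 i - u 0 i) ^+ 2); last first.
  by apply/funext => u; rewrite enorm_sqr; apply: eq_bigr => i _; rewrite !mxE.
elim: (index_enum _) => [|i s IH].
  rewrite (_ : (fun u => _) = cst 0); first exact: cst_continuous.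
  by apply/funext => u; rewrite big_nil.
rewrite (_ : (fun u => _) = (fun u : 'rV[R]_n => (x 0 i - u 0 i) * (x 0 i - u 0 i))
    \+ fun u => \sum_(j <- s) (x 0 j - u 0 j) ^+ 2); last first.
  by apply/funext => u; rewrite big_cons expr2.
have h : continuous (fun v : 'rV[R]_n => x 0 i - v 0 i).
  by move=> u; apply: continuousB; [exact: cst_continuous|exact: coord_continuous].
by move=> u; apply: continuousD; [apply: continuousM; exact: h|exact: IH].
Qed.

Lemma closed_coord_le (i j : 'I_n) : closed [set u : 'rV[R]_n | u 0 i <= u 0 j].
Proof.
rewrite (_ : [set u | _] = (fun u : 'rV[R]_n => u 0 j - u 0 i) @^-1` [set t | 0 <= t]); last first.
  by apply/seteqP; split=> u /=; rewrite subr_ge0.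
apply: preimage_closed; last exact: closed_ge.
by move=> u _; apply: continuousB; exact: coord_continuous.
Qed.

Lemma closed_sorted (s : seq 'I_n) : closed [set u : 'rV[R]_n | sorted <=%R [seq u 0 k | k <- s]].
Proof.
have closed_true (P : 'rV[R]_n -> Prop) : (forall u, P u) -> closed [set u | P u].
  move=> PT; rewrite (_ : [set u | P u] = setT); first exact: closedT.
  by apply/seteqP; split => [//|u _]; exact: PT.
elim: s => [|i [|j s] IH]; [exact: closed_true|exact: closed_true|].
rewrite (_ : [set u | _] = [set u : 'rV[R]_n | u 0 i <= u 0 j] `&`
  [set u : 'rV[R]_n | sorted <=%R [seq u 0 k | k <- j :: s]]).
  by apply: closedI => //; exact: closed_coord_le.
by apply/seteqP; split => u /= /andP.
Qed.

Lemma continuous_tv (s : seq 'I_n) :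
  continuous (fun u : 'rV[R]_n => tv [seq u 0 k | k <- s]).
Proof.
elim: s => [|i [|j s] IH].
- rewrite (_ : (fun u => _) = cst 0); first exact: cst_continuous.
  by apply/funext => u; rewrite tv_nil.
- rewrite (_ : (fun u => _) = cst 0); first exact: cst_continuous.
  by apply/funext => u; rewrite tv1.
rewrite (_ : (fun u => _) = (fun u : 'rV[R]_n => `|u 0 i - u 0 j|)
    \+ fun u => tv [seq u 0 k | k <- j :: s]); last first.
  by apply/funext => u; rewrite /= tv_cons.
have h : continuous (fun v : 'rV[R]_n => v 0 i - v 0 j).
  by move=> u; apply: continuousB; exact: coord_continuous.
move=> u; apply: continuousD; last exact: IH.
by apply: continuous_comp; [exact: h|exact: norm_continuous].
Qed.

Lemma closed_Kup m (A : 'I_m -> {set 'I_n}) (V : 'I_m -> R) : closed (Kup A V).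
Proof.
rewrite (_ : Kup A V = \bigcap_(i in [set: 'I_m])
  ([set u : 'rV[R]_n | sorted <=%R (subvec u (A i))] `&`
   (fun u : 'rV[R]_n => tv (subvec u (A i))) @^-1` [set t | t <= V i])).
  apply: closed_bigI => i _; apply: closedI; first exact: closed_sorted.
  by apply: preimage_closed; [move=> u _; exact: continuous_tv|exact: closed_le].
apply/seteqP; split=> [u [u1 u2] i _|u h]; first by split; [exact: u1|exact: u2].
by split=> i; have [] := h i I.
Qed.

(** Only the points of [K] in a cube around [x] compete, and they form a compact
    set. *)
Lemma proj_exists (K : set 'rV[R]_n) x : closed K -> K !=set0 ->
  exists p, is_proj K x p.
Proof.
move=> cK [p0 Kp0]; pose r := enorm (x - p0).
pose box := [set u : 'rV[R]_n | forall i, `[x ord0 i - r, x ord0 i + r]%classic (u ord0 i)].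
have cbox : compact box.
  apply: (@rV_compact R n (fun i => `[x ord0 i - r, x ord0 i + r]%classic)) => i.
  exact: segment_compact.
have coord_le u i : `|x 0 i - u 0 i| <= enorm (x - u).
  rewrite -(ler_pXn2r (n := 2)) ?nnegrE ?enorm_ge0// enorm_sqr (bigD1 i)//= !mxE.
  by rewrite real_normK ?num_real// lerDl sumr_ge0// => j _; exact: sqr_ge0.
have in_box u : enorm (x - u) <= r -> box u.
  move=> ur i /=; rewrite in_itv/=.
  by have := le_trans (coord_le u i) ur; rewrite ler_norml => /andP[h1 h2]; apply/andP; split; lra.
have cC : compact (box `&` K) by exact: compact_closedI.
have C0 : box `&` K !=set0 by exists p0; split => //; exact: in_box.
have [c cC' cmin] := @EVT_min_rV R n (fun u => enorm (x - u) ^+ 2) _ C0 cC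
  (continuous_subspaceT (@continuous_enorm_sqr x)).
move: cC' => /set_mem[_ Kc]; exists c; split => // u Ku.
have [ur|ru] := leP (enorm (x - u)) r.
  by rewrite enorm_le_sqr; apply: cmin; apply/mem_set; split => //; exact: in_box.
apply: le_trans (ltW ru); rewrite enorm_le_sqr; apply: cmin; apply/mem_set.
by split => //; exact: in_box.
Qed.

Lemma estimatorP m (A : 'I_m -> {set 'I_n}) (V : 'I_m -> R) x :
  (forall i, 0 <= V i) -> is_proj (Kup A V) x (estimator x A V).
Proof.
move=> V0; have [p pP] : exists p, is_proj (Kup A V) x p.
  apply: proj_exists; first exact: closed_Kup.
  exists 0; split => i.
    rewrite /subvec; elim: (enum _) => [|j [|k s] IH] //=.
    by apply/andP; split; [rewrite !mxE|exact: IH].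
  rewrite (le_trans _ (V0 i))// le_eqVlt; apply/orP; left; apply/eqP.
  rewrite /subvec; elim: (enum _) => [|j [|k s] IH]; rewrite ?tv_nil ?tv1//.
  by rewrite /= tv_cons IH !mxE subrr normr0 addr0.
by rewrite /estimator /proj; exact: (xgetPex 0 (ex_intro _ p pP)).
Qed.

Lemma dist_attained (K : set 'rV[R]_n) x p : is_proj K x p -> enorm (x - p) <= dist x K.
Proof.
move=> [Kp pmin]; apply: lb_le_inf; first by exists (enorm (x - p)); exists p.
by move=> _ [u Ku <-]; exact: pmin.
Qed.
End projection.

(** * Oracle inequality *)

Section oracle.
Context (R : realType) (n : nat).
Hypothesis n0 : (0 < n)%N.

Lemma Vset_gt0 m (V : 'I_m -> R) : Vset V -> forall i, 0 < V i.
Proof. by move=> [j jV] i; have [j0 ->] := jV i; rewrite powR_gt0// ltr0n. Qed.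

Lemma complexity_ge m (A : 'I_m -> {set 'I_n}) (V : 'I_m -> R) (sigma : R) :
  connected_partition A -> 0 <= sigma -> sigma ^+ 2 <= complexity sigma A V.
Proof.
move=> cpA s0; have m0 := partition_pos cpA n0.
have rate0 : 0 <= \sum_(i < m) block_rate sigma #|A i|%:R (V i).
  by apply: sumr_ge0 => i _; rewrite !mulr_ge0 ?powR_ge0.
have h : 1 <= entropy R n m.
  by apply: le_trans (entropy_ge R (partition_size cpA)); rewrite ler1n.
have : sigma ^+ 2 * 1 <= sigma ^+ 2 * entropy R n m by rewrite ler_wpM2l ?sqr_ge0.
rewrite /complexity; lra.
Qed.

(** The basic inequality combined with [noise_bound] and
    [|u - f|^2 <= 2 |u - theta|^2 + 2 |f - theta|^2]; the constant [50 * 100] is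
    that of [noise_bound]. *)
Lemma pathwise_oracle (Cpen sigma : R) (theta y : 'rV[R]_n)
    m' (A' : 'I_m' -> {set 'I_n}) (V' : 'I_m' -> R)
    m (A : 'I_m -> {set 'I_n}) (V : 'I_m -> R) (f : 'rV[R]_n) :
  0 < sigma -> (50 * 100) <= Cpen -> is_minimizer Cpen sigma y A' V' ->
  connected_partition A -> Vset V -> Kup A V f ->
  ((enorm (estimator y A' V' - theta) ^+ 2)%:E <=
   (5 / 3 * enorm (f - theta) ^+ 2
     + 4 / 3 * (pen Cpen sigma A V + (50 * 100) * complexity sigma A V))%:E
   + (4 / 3 * (64 * sigma ^+ 2))%:E *
     union_majorant (fun i => (y ord0 i - theta ord0 i) / sigma)%R)%E.
Proof.
move=> s0 CC [cpA' V'S minA'] cpA VS fK.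
have V0 := Vset_gt0 VS; have V'0 := Vset_gt0 V'S.
have [uK _] := estimatorP A' y (fun i => ltW (V'0 i)).
have [_ /(_ f fK)] := estimatorP A y (fun i => ltW (V0 i)).
rewrite enorm_le_sqr => yf.
have := minA' m A V cpA VS; rewrite /criterion => crit.
set u := estimator y A' V' in uK crit *.
pose z i := (y ord0 i - theta ord0 i) / sigma.
have noise := noise_bound cpA cpA' V0 V'0 s0
  (f := fun i => f ord0 i) (u := fun i => u ord0 i) z fK.2 uK.2.
have uf : enorm (u - theta) ^+ 2 <= enorm (f - theta) ^+ 2
   + 2 * sigma * (\sum_i z i * (u ord0 i - f ord0 i))
   + (pen Cpen sigma A V - pen Cpen sigma A' V').
  have E v : enorm (y - v) ^+ 2 = enorm (v - theta) ^+ 2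
     - 2 * sigma * (\sum_i z i * (v ord0 i - theta ord0 i))
     + \sum_i (y ord0 i - theta ord0 i) ^+ 2.
    rewrite !enorm_sqr mulr_sumr -sumrB -big_split/=; apply: eq_bigr => i _.
    by rewrite !mxE /z; field; rewrite gt_eqF.
  have S : \sum_i z i * (u ord0 i - f ord0 i) =
     \sum_i z i * (u ord0 i - theta ord0 i) - \sum_i z i * (f ord0 i - theta ord0 i).
    by rewrite -sumrB; apply: eq_bigr => i _; ring.
  move: crit yf; rewrite (E u) (E f) S; lra.
have sq : \sum_i (u ord0 i - f ord0 i) ^+ 2 <=
    2 * enorm (u - theta) ^+ 2 + 2 * enorm (f - theta) ^+ 2.
  rewrite !enorm_sqr !mulr_sumr -big_split/=; apply: ler_sum => i _.
  rewrite !mxE; set a := u _ _; set b := f _ _; set t := theta _ _.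
  have : 0 <= (a + b - 2 * t) ^+ 2 by exact: sqr_ge0.
  nra.
have c'0 : 0 <= complexity sigma A' V'.
  by apply: le_trans (complexity_ge _ cpA' (ltW s0)); exact: sqr_ge0.
have pen' : (50 * 100) * complexity sigma A' V' <= pen Cpen sigma A' V'.
  by rewrite penE ler_wpM2r.
have s2 : 0 < sigma ^+ 2 by rewrite exprn_gt0.
move: noise; case: (union_majorant z) (union_majorant_ge0 z) => [Y| |//] Y0 noise.
  move: noise; rewrite -!EFinM -!EFinD !lee_fin; lra.
have b0 : 0 < 4 / 3 * (64 * sigma ^+ 2) by lra.
by move: (4 / 3 * _) b0 => b b0; rewrite gt0_muley ?lte_fin// addey// leey.
Qed.

(** The requirement on [Cpen] is [4/3 (50 * 100 + 128) <= Cpen / 6], where [128] is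
    the mean bound of [64 Y]; this brings the factor of the penalty from [4/3] to
    [3/2]. *)
Lemma expected_oracle (Cpen sigma : R) (theta : 'rV[R]_n)
    d (T : measurableType d) (P : probability T R) (y : T -> 'rV[R]_n)
    (mhat : T -> nat) (Ahat : forall w, 'I_(mhat w) -> {set 'I_n})
    (Vhat : forall w, 'I_(mhat w) -> R)
    m (A : 'I_m -> {set 'I_n}) (V : 'I_m -> R) (f : 'rV[R]_n) :
  0 < sigma -> (500 * 100) <= Cpen -> gaussian_vector P y theta sigma ->
  (forall w, is_minimizer Cpen sigma (y w) (Ahat w) (Vhat w)) ->
  connected_partition A -> Vset V -> Kup A V f ->
  ('E_P[fun w => (enorm (estimator (y w) (Ahat w) (Vhat w) - theta) ^+ 2)%R] <=
   (5 / 3 * enorm (f - theta) ^+ 2 + 3 / 2 * pen Cpen sigma A V)%:E)%E.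
Proof.
move=> s0 CC Py hat_min cpA VS fK.
have Pz := gaussian_vector_white_noise s0 Py; have [mz _] := Pz.
set z := (fun w i => _) in Pz mz.
have s2 : 0 < sigma ^+ 2 by rewrite exprn_gt0.
have cs := complexity_ge V cpA (ltW s0).
have pc : Cpen * complexity sigma A V = pen Cpen sigma A V by rewrite penE.
have p0 : (500 * 100) * complexity sigma A V <= pen Cpen sigma A V.
  by rewrite -pc ler_wpM2r// (le_trans _ cs)// ltW.
have D0 : 0 <= enorm (f - theta) ^+ 2 by exact: sqr_ge0.
set K := 5 / 3 * enorm (f - theta) ^+ 2
     + 4 / 3 * (pen Cpen sigma A V + (50 * 100) * complexity sigma A V).
have KE : K = 5 / 3 * enorm (f - theta) ^+ 2
     + 4 / 3 * (pen Cpen sigma A V + (50 * 100) * complexity sigma A V) by [].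
have K0 : 0 <= K by lra.
rewrite expectation.unlock.
apply: (@le_trans _ _ (\int[P]_w (K%:E + (4 / 3 * (64 * sigma ^+ 2))%:E * union_majorant (z w)))%E).
  apply: ge0_le_integralT => w; first by rewrite lee_fin sqr_ge0.
  by apply: pathwise_oracle (hat_min w) cpA VS fK => //; lra.
set b := 4 / 3 * (64 * sigma ^+ 2).
have bE : b = 4 / 3 * (64 * sigma ^+ 2) by [].
have c0 : 0 <= b by lra.
clearbody b.
clearbody K.
rewrite ge0_integralD//; last 2 first.
- by move=> w _; rewrite mule_ge0 ?lee_fin ?union_majorant_ge0.
- by apply: measurable_funeM; exact: measurable_union_majorant.
rewrite integral_cst// (_ : _ [set: T] = 1%E) ?mule1; last exact: probability_setT.
rewrite ge0_integralZl//; last 2 first.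
- exact: measurable_union_majorant.
- by move=> w _; exact: union_majorant_ge0.
apply: (@le_trans _ _ (K%:E + b%:E * 2%:E)%E).
  apply: leeD2l; apply: lee_wpmul2l; rewrite ?lee_fin//.
  exact: (union_majorant_mean n0 Pz).
rewrite -EFinM -EFinD lee_fin KE bE; lra.
Qed.

End oracle.

(** * Attainment of the oracle bound and rounding of the variations *)

Section minimum.
Context (R : realType) (n : nat).
Hypothesis n0 : (0 < n)%N.

Lemma block_rate_level (sigma a : R) (j : nat) : 0 < sigma -> (0 < j)%N ->
  block_rate sigma a (j%:R `^ (3 / 2)) = sigma `^ (4 / 3) * a `^ (1 / 3) * j%:R.
Proof.
move=> s0 j0; rewrite /block_rate -powRrM (_ : 3 / 2 * (2 / 3) = 1 :> R); last by field.
by rewrite powRr1.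
Qed.

Lemma one_block_partition : connected_partition (fun _ : 'I_1 => [set: 'I_n]%SET).
Proof.
split.
- by move=> i; apply/set0Pn; exists (Ordinal n0); rewrite inE.
- by move=> i j; rewrite !ord1 eqxx.
- by move=> k; exists ord0; rewrite inE.
- by move=> *; rewrite inE.
- by move=> i j; rewrite !ord1.
Qed.

(** The bound is at least a positive multiple of every [j_i], so that only
    finitely many pairs do better than the partition into one block at level one. *)
Lemma is_min_oracle (Cpen sigma : R) (theta : 'rV[R]_n) :
  0 < Cpen -> 0 < sigma ->
  exists b, is_min [set x | exists (m : nat) (A : 'I_m -> {set 'I_n}) (V : 'I_m -> R),
    [/\ connected_partition A, Vset V &
       x = 3 / n%:R * dist theta (Kup A V) ^+ 2 + 2 / n%:R * pen Cpen sigma A V]] b.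
Proof.
move=> C0 s0.
pose cost m (A : 'I_m -> {set 'I_n}) (V : 'I_m -> R) : R :=
  3 / n%:R * dist theta (Kup A V) ^+ 2 + 2 / n%:R * pen Cpen sigma A V.
have nR : 0 < n%:R :> R by rewrite ltr0n.
pose c : R := 2 / n%:R * (Cpen * sigma `^ (4 / 3)).
have c0 : 0 < c by rewrite mulr_gt0 ?divr_gt0 ?mulr_gt0 ?powR_gt0.
have level_le m (A : 'I_m -> {set 'I_n}) (V : 'I_m -> R) (j : 'I_m -> nat) i :
    connected_partition A -> (forall k, (0 < j k)%N /\ V k = (j k)%:R `^ (3 / 2)) ->
    c * (j i)%:R <= cost m A V.
  move=> cpA jV; have A1 : 1 <= #|A i|%:R `^ (1 / 3) :> R.
    rewrite -[leLHS](_ : 1 `^ (1 / 3) = 1); last by rewrite powR1.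
    apply: ge0_ler_powR; rewrite ?nnegrE//.
    by rewrite ler1n card_gt0; exact: cp_nonempty cpA i.
  have pe : Cpen * sigma `^ (4 / 3) * (j i)%:R <= pen Cpen sigma A V.
    rewrite penE -mulrA ler_pM2l// /complexity (bigD1 i)//=.
    have [ji ->] := jV i; rewrite block_rate_level//.
    have h1 : 0 <= \sum_(k < m | k != i) block_rate sigma #|A k|%:R (V k).
      by apply: sumr_ge0 => k _; rewrite !mulr_ge0 ?powR_ge0.
    have h2 : 0 <= sigma ^+ 2 * entropy R n m.
      rewrite mulr_ge0 ?sqr_ge0//.
      by rewrite (le_trans _ (entropy_ge R (partition_size cpA))).
    have h3 : sigma `^ (4 / 3) * (j i)%:R <=
        sigma `^ (4 / 3) * #|A i|%:R `^ (1 / 3) * (j i)%:R.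
      by rewrite ler_wpM2r// ler_peMr// powR_ge0.
    lra.
  rewrite /cost /c -[X in X <= _]mulrA.
  have d0 : 0 <= 3 / n%:R * dist theta (Kup A V) ^+ 2.
    by rewrite mulr_ge0 ?sqr_ge0// divr_ge0.
  apply: (@le_trans _ _ (2 / n%:R * pen Cpen sigma A V)); last by rewrite lerDr.
  by rewrite ler_pM2l// divr_gt0.
(* reference value: the partition into one block *)
pose x0 := cost 1%N (fun=> [set: 'I_n]%SET) (fun=> 1).
have one_V : forall k : 'I_1, (0 < 1)%N /\ (1 : R) = 1%:R `^ (3 / 2).
  by move=> _; rewrite powR1.
have x00 : 0 <= x0 / c.
  rewrite divr_ge0 ?(ltW c0)//.
  have := level_le 1%N _ _ (fun=> 1%N) ord0 one_block_partition one_V.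
  by apply: le_trans; rewrite mulr1 ltW.
pose K := (Num.trunc (x0 / c)).+1.
pose FT (m : 'I_n.+1) : finType := ({ffun 'I_m -> {set 'I_n}} * {ffun 'I_m -> 'I_K.+1})%type.
pose G : finType := {m : 'I_n.+1 & FT m}.
pose gA (g : G) : 'I_(tag g) -> {set 'I_n} := fun i => (tagged g).1 i.
pose gj (g : G) : 'I_(tag g) -> nat := fun i => (tagged g).2 i.
pose gV (g : G) : 'I_(tag g) -> R := fun i => (gj g i)%:R `^ (3 / 2).
pose valid (g : G) := `[< connected_partition (gA g) /\ forall i, (0 < gj g i)%N >].
have encode m (A : 'I_m -> {set 'I_n}) (V : 'I_m -> R) :
    connected_partition A -> Vset V -> cost m A V <= x0 ->
    exists2 g : G, valid g & cost _ (gA g) (gV g) = cost m A V.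
  move=> cpA [j jV] le0.
  have mn : (m < n.+1)%N by rewrite ltnS; exact: partition_size cpA.
  have jK i : (j i < K.+1)%N.
    have h : (j i)%:R <= x0 / c.
      by rewrite ler_pdivlMr// mulrC (le_trans (level_le m A V j i cpA jV)).
    have /andP[_ h'] := truncn_itv x00.
    by have := le_lt_trans h h'; rewrite ltr_nat => /ltnW.
  pose g : G := existT FT (Ordinal mn) ([ffun i => A i], [ffun i => Ordinal (jK i)]).
  have gAE : gA g = A by apply/funext => i; rewrite /gA /= ffunE.
  have gjE i : gj g i = j i by rewrite /gj /= ffunE.
  have gVE : gV g = V.
    by apply/funext => i; rewrite /gV gjE; have [_ ->] := jV i.
  exists g; last by rewrite gAE gVE.
  apply/asboolP; rewrite gAE; split => // i; rewrite gjE.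
  by have [] := jV i.
have [g0 vg0 cg0] : exists2 g : G, valid g & cost _ (gA g) (gV g) = x0.
  by apply: encode => //; [exact: one_block_partition|exists (fun=> 1%N)].
have [g vg gmin] := arg_minP (fun g => cost _ (gA g) (gV g)) vg0.
exists (cost _ (gA g) (gV g)); split.
  move/asboolP: vg => [cpg jg]; exists (tag g), (gA g), (gV g); split => //.
  by exists (gj g).
move=> _ [m [A [V [cpA VS ->]]]]; rewrite -/(cost m A V).
have [le0|lt0] := leP (cost m A V) x0.
  by have [g' vg' <-] := encode m A V cpA VS le0; exact: gmin.
by rewrite (le_trans (gmin _ vg0))// cg0 ltW.
Qed.

End minimum.

(** With [s = v^(1/3)], the integer [j] just above [s^2] satisfies [j <= s^2 + 1],
    and [(s^2 + 1)^3 <= 2 (s^3 + 1)^2] because the difference is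
    [(s - 1)^2 (s^4 + 2 s^3 + 2 s + 1)]. *)
Lemma level_ceiling (R : realType) (v : R) : 0 <= v ->
  exists j : nat, [/\ (0 < j)%N, v <= j%:R `^ (3 / 2) &
    3 / 2 * j%:R <= 2 * (v + 1) `^ (2 / 3)].
Proof.
move=> v0; pose s := cbrt v.
have s0 : 0 <= s by exact: powR_ge0.
have s3 : s ^+ 3 = v.
  by rewrite -powR_mulrn// /s /cbrt -powRrM (_ : 1 / 3 * 3%:R = 1) ?powRr1//; field.
have s2 : 0 <= s ^+ 2 by exact: sqr_ge0.
have /andP[sj js] := truncn_itv s2.
exists (Num.trunc (s ^+ 2)).+1; split => //.
  have -> : v = (s ^+ 2) `^ (3 / 2).
    rewrite -powR_mulrn// -powRrM (_ : 2%:R * (3 / 2) = 3%:R :> R); last by field.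
    by rewrite powR_mulrn.
  by apply: ge0_ler_powR; rewrite ?nnegrE ?divr_ge0// ltW.
have v1 : 0 < v + 1 by lra.
have q0 := cbrt_gt0 v1; have q3 := cbrtK v1.
rewrite -(cbrtX 2 v1); set q := cbrt (v + 1) in q0 q3 *.
have q2 : 0 <= q ^+ 2 by exact: sqr_ge0.
have key : s ^+ 2 + 1 <= 4 / 3 * q ^+ 2.
  rewrite -(ler_pXn2r (n := 3)) ?nnegrE//; try lra.
  have -> : (4 / 3 * q ^+ 2) ^+ 3 = 64 / 27 * (s ^+ 3 + 1) ^+ 2.
    by rewrite s3 -q3; field.
  have h1 : 0 <= (s - 1) ^+ 2 * (s ^+ 4 + 2 * s ^+ 3 + 2 * s + 1).
    by rewrite mulr_ge0 ?sqr_ge0// !addr_ge0 ?mulr_ge0 ?exprn_ge0.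
  have h2 : 0 <= (s ^+ 3 + 1) ^+ 2 by exact: sqr_ge0.
  have h3 : 2 * (s ^+ 3 + 1) ^+ 2 - (s ^+ 2 + 1) ^+ 3 =
    (s - 1) ^+ 2 * (s ^+ 4 + 2 * s ^+ 3 + 2 * s + 1) by ring.
  lra.
rewrite -addn1 natrD; lra.
Qed.

Lemma rate_normalized (R : realType) (sigma a t : R) : 0 < sigma -> 0 < a -> 0 < t ->
  a * (sigma ^+ 2 * t / a) `^ (2 / 3) = sigma `^ (4 / 3) * a `^ (1 / 3) * t `^ (2 / 3).
Proof.
move=> s0 a0 t0.
have x0 : 0 < sigma ^+ 2 * t / a by rewrite divr_gt0 ?mulr_gt0 ?exprn_gt0.
have E : cbrt (sigma ^+ 2 * t / a) = cbrt sigma ^+ 2 * cbrt t / cbrt a.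
  apply/eqP; rewrite -(eqrXn2 (n := 3))//; first last.
  - by rewrite divr_ge0 ?mulr_ge0 ?exprn_ge0// ltW// cbrt_gt0.
  - by rewrite ltW// cbrt_gt0.
  rewrite cbrtK// -{1}(cbrtK s0) -{1}(cbrtK t0) -{1}(cbrtK a0); apply/eqP.
  by field; rewrite gt_eqF// cbrt_gt0.
rewrite -(cbrtX 2 x0) -(cbrtX 4 s0) -(cbrtX 1 a0) -(cbrtX 2 t0) E.
rewrite -{1}(cbrtK a0); field.
by rewrite gt_eqF// cbrt_gt0.
Qed.

(** * Risk of the penalized estimator *)

Theorem theorem5p1 (R : realType) :
  exists2 Cpen : R, 0 < Cpen &
  forall (n : nat) (sigma : R) (theta : 'rV[R]_n),
  (1 <= n)%N -> 0 < sigma ->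
  forall (d : measure_display) (T : measurableType d) (P : probability T R)
    (y : T -> 'rV[R]_n),
  gaussian_vector P y theta sigma ->
  forall (mhat : T -> nat) (Ahat : forall w, 'I_(mhat w) -> {set 'I_n})
    (Vhat : forall w, 'I_(mhat w) -> R),
  (forall w, is_minimizer Cpen sigma (y w) (Ahat w) (Vhat w)) ->
  let risk : \bar R :=
    ((n%:R^-1)%:E *
     'E_P[fun w => (enorm (estimator (y w) (Ahat w) (Vhat w) - theta) ^+ 2)%R])%E in
  (exists b : R,
     is_min [set x | exists (m : nat) (A : 'I_m -> {set 'I_n}) (V : 'I_m -> R),
               [/\ connected_partition A, Vset V &
                   x = 3 / n%:R * dist theta (Kup A V) ^+ 2
                       + 2 / n%:R * pen Cpen sigma A V]] b /\
     (risk <= (b + 256 * sigma ^+ 2 / n%:R)%:E)%E) /\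
  (forall (m : nat) (A : 'I_m -> {set 'I_n}),
     connected_partition A -> piecewise_monotone A theta ->
     (risk <= (2 * Cpen *
                 (\sum_(i < m) #|A i|%:R / n%:R *
                    (sigma ^+ 2 * (tv (subvec theta (A i)) + 1)
                       / #|A i|%:R) `^ (2 / 3)
                  + sigma ^+ 2 * m%:R / n%:R * ln (expR 1 * n%:R / m%:R))
               + 256 * sigma ^+ 2 / n%:R)%:E)%E).
Proof.
have [Cpen C0 CC] : exists2 C : R, 0 < C & 500 * 100 <= C.
  by exists (500 * 100); lra.
exists Cpen => // n sigma theta n0 s0 d T P y Py mhat Ahat Vhat hat_min risk.
have nR : 0 < n%:R :> R by rewrite ltr0n.
pose e := 256 * sigma ^+ 2 / n%:R.
have e0 : 0 <= e by rewrite /e -mulrA mulr_ge0 ?ler0n// divr_ge0 ?sqr_ge0// ltW.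
have risk_le m (A : 'I_m -> {set 'I_n}) (V : 'I_m -> R) (f : 'rV[R]_n) :
    connected_partition A -> Vset V -> Kup A V f ->
    (risk <= (n%:R^-1 * (5 / 3 * enorm (f - theta) ^+ 2
                         + 3 / 2 * pen Cpen sigma A V))%:E)%E.
  move=> cpA VS fK; rewrite /risk [leRHS]EFinM; apply: lee_wpmul2l.
    by rewrite lee_fin invr_ge0 ltW.
  exact: expected_oracle.
have pen0 m (A : 'I_m -> {set 'I_n}) (V : 'I_m -> R) :
    connected_partition A -> 0 <= pen Cpen sigma A V.
  move=> cpA; rewrite penE mulr_ge0 ?(ltW C0)//.
  by apply: le_trans (complexity_ge n0 V cpA (ltW s0)); exact: sqr_ge0.
split.
  have [b [bmem bmin]] := is_min_oracle n0 theta C0 s0.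
  exists b; split; first by split.
  move: bmem => [m [A [V [cpA VS ->]]]]; rewrite -/e.
  have projP := estimatorP A theta (fun i => ltW (Vset_gt0 VS i)).
  have fK : Kup A V (estimator theta A V) by case: projP.
  apply: (le_trans (risk_le _ _ _ _ cpA VS fK)); rewrite lee_fin.
  set f := estimator theta A V in fK *.
  have fd : enorm (f - theta) ^+ 2 <= dist theta (Kup A V) ^+ 2.
    have -> : enorm (f - theta) = enorm (theta - f).
      by congr Num.sqrt; apply: eq_bigr => i _; rewrite !mxE -sqrrN opprB.
    have h := dist_attained projP.
    by rewrite ler_pXn2r ?nnegrE ?enorm_ge0// (le_trans (enorm_ge0 _) h).
  have := pen0 _ A V cpA; have := sqr_ge0 (enorm (f - theta)).
  set p := pen _ _ _ _; set D := dist _ _ ^+ 2 in fd *; set E := enorm _ ^+ 2 in fd *.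
  move=> E0 p0; rewrite (_ : 3 / n%:R * D + _ = n%:R^-1 * (3 * D + 2 * p)); last by ring.
  apply: (@le_trans _ _ (n%:R^-1 * (3 * D + 2 * p))); last by rewrite lerDl.
  by rewrite ler_pM2l ?invr_gt0//; lra.
move=> m A cpA pmA; rewrite -/e.
have tv0 i := tv_ge0 (subvec theta (A i)).
have [j jP] := choice (fun i => level_ceiling (tv0 i)).
pose V i : R := (j i)%:R `^ (3 / 2).
have VS : Vset V by exists j => i; have [] := jP i.
have fK : Kup A V theta by split => // i; have [] := jP i.
apply: (le_trans (risk_le _ _ _ _ cpA VS fK)); rewrite lee_fin.
have -> : enorm (theta - theta) ^+ 2 = 0.
  by rewrite enorm_sqr big1// => i _; rewrite !mxE subrr expr0n.
rewrite mulr0 add0r penE.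
set S := \sum_(i < m) _ : R; set L := _ * ln _.
have rates : 3 / 2 * \sum_(i < m) block_rate sigma #|A i|%:R (V i) <= 2 * n%:R * S.
  rewrite !mulr_sumr; apply: ler_sum => i _.
  have A0 : 0 < #|A i|%:R :> R.
    by rewrite ltr0n card_gt0; exact: cp_nonempty cpA i.
  have t0 : 0 < tv (subvec theta (A i)) + 1 by have := tv0 i; lra.
  have [j0 _ jle] := jP i.
  rewrite (_ : 2 * n%:R * _ = 2 * (#|A i|%:R *
     (sigma ^+ 2 * (tv (subvec theta (A i)) + 1) / #|A i|%:R) `^ (2 / 3))); last first.
    by field; rewrite gt_eqF.
  rewrite rate_normalized// /V block_rate_level// mulrCA [leRHS]mulrCA.
  by rewrite ler_wpM2l// mulr_ge0 ?powR_ge0.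
have logs : sigma ^+ 2 * entropy R n m = n%:R * L.
  by rewrite /L /entropy; field; rewrite gt_eqF.
have L0 : 0 <= L.
  rewrite -(ler_pM2l nR) mulr0 -logs mulr_ge0 ?sqr_ge0//.
  by rewrite (le_trans _ (entropy_ge R (partition_size cpA))).
apply: (@le_trans _ _ (2 * Cpen * (S + L))); last by rewrite lerDl.
rewrite /complexity logs.
rewrite (_ : 2 * Cpen * (S + L) = n%:R^-1 * (Cpen * (2 * n%:R * S + 2 * n%:R * L))); last first.
  by field; rewrite gt_eqF.
rewrite ler_pM2l ?invr_gt0// mulrCA ler_pM2l//.
have : 0 <= n%:R * L by rewrite mulr_ge0// ltW.
lra.
Qed.
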